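(* Let $F$ be a forest with no vertex of degree $3$. Suppose that for every vertex $b$ of $F$ and every color $\alpha$, coloring $b$ with $\alpha$ produces a partially colored forest in which some trunk $R'$ of the reduced graph $\mathcal{R}'(F)$ either (i) has exactly one colored vertex and contains an edge of $E_{>>2}(\mathcal{R}'(F))$, or (ii) has no colored vertices and no vertex $v\in V(R')$ covers $E_{>>2}(R')$. Then $\chi_{\mathrm{g}}(F)=4$.
   Context: $\chi_{\mathrm{g}}(G)$ is the least $t$ such that Alice has a winning strategy in the $t$-coloring game on $G$: Alice and Bob alternate turns, Alice first, coloring uncolored vertices with colors from a $t$-set so that no vertex gets a color used on a neighbor; Bob wins if some uncolored vertex has no available color, Alice wins if all vertices get colored. (It is known that $\chi_{\mathrm{g}}(F)\le 4$ for every forest.) For a partially colored forest $F$, a trunk of $F$ is a maximal connected subgraph $R$ such that every colored vertex of $R$ is a leaf of $R$; $\mathcal{R}(F)$ is the partially colored forest formed by the disjoint union of all trunks of $F$ (a colored vertex lying in several trunks appears as a separate colored copy in each). For a graph $G$, $E_{>2}(G)$ is the set of edges $xy$ with $d_G(x)>2$ or $d_G(y)>2$, and $E_{>>2}(G)$ the set of edges $xy$ with $d_G(x)>2$ and $d_G(y)>2$. The reduced graph is $\mathcal{R}'(F)=\mathcal{R}(F)-\{xy: xy\notin E_{>2}(\mathcal{R}(F))\}$; its trunks are defined as for any partially colored forest. A vertex $v$ covers a set of edges if $v$ is an endpoint of every edge in the set. *)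

(* Defs.v *)
From mathcomp Require Import all_boot.

Set Implicit Arguments.
Unset Strict Implicit.
Unset Printing Implicit Defensive.

(* The input forest F: a finite simple graph on a finType T, given by a
   symmetric irreflexive relation e. *)

Definition forest (T : finType) (e : rel T) : Prop :=
  ~ exists (x : T) (p : seq T),
      [&& uniq (x :: p), 1 < size p, path e x p & e (last x p) x].

Section Game.
Variables (T : finType) (e : rel T) (t : nat).

Definition pcol := {ffun T -> option 'I_t}.

Definition available (c : pcol) (v : T) (a : 'I_t) : Prop :=
  forall u, e u v -> c u <> Some a.

Definition legal (c : pcol) (v : T) (a : 'I_t) : Prop :=
  c v = None /\ available c v a.

Definition all_colored (c : pcol) : Prop := forall v, c v <> None.

(* some uncolored vertex has no available color: Bob has won *)
Definition blocked (c : pcol) : Prop :=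
  exists v, c v = None /\ forall a, ~ available c v a.

Definition upd (c : pcol) (v : T) (a : 'I_t) : pcol :=
  [ffun x => if x == v then Some a else c x].

Inductive alice_wins : bool -> pcol -> Prop :=
| aw_done turn c : all_colored c -> alice_wins turn c
| aw_alice c : ~ all_colored c -> ~ blocked c ->
    (exists v a, legal c v a /\ alice_wins false (upd c v a)) ->
    alice_wins true c
| aw_bob c : ~ all_colored c -> ~ blocked c ->
    (forall v a, legal c v a -> alice_wins true (upd c v a)) ->
    alice_wins false c.

Definition alice_wins_game : Prop := alice_wins true [ffun _ => None].

End Game.

Definition game_chromatic_number_is (T : finType) (e : rel T) (k : nat) : Prop :=
  alice_wins_game e k /\ forall t, alice_wins_game e t -> k <= t.

(* General partially colored graphs inside an ambient finType T:
   a vertex set V, a (symmetric) set of ordered pairs E encoding the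
   edges, and a partial coloring col (None = uncolored). *)

Section Graphs.
Variable T : finType.
Implicit Types (V S : {set T}) (E D : {set T * T}).

Definition deg V E (x : T) : nat := #|[set y in V | (x, y) \in E]|.

Definition subgraphb V E S D : bool :=
  [&& S \subset V, D \subset E &
      [forall p in D, [&& p.1 \in S, p.2 \in S & (p.2, p.1) \in D]]].

Definition connectedb S D : bool :=
  (S != set0) &&
  [forall x in S, forall y in S, connect (fun a b => (a, b) \in D) x y].

Definition trunk_cond (K : Type) V E (col : T -> option K) S D : bool :=
  [&& subgraphb V E S D, connectedb S D &
      [forall x in S, isSome (col x) ==> (deg S D x == 1)]].

Definition is_trunk (K : Type) V E (col : T -> option K) S D : bool :=
  trunk_cond V E col S D &&
  [forall S' : {set T}, forall D' : {set T * T},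
     [&& trunk_cond V E col S' D', S \subset S' & D \subset D'] ==>
     ((S' == S) && (D' == D))].

Definition E_gt2 V E : {set T * T} :=
  [set p in E | (2 < deg V E p.1) || (2 < deg V E p.2)].
Definition E_ggt2 V E : {set T * T} :=
  [set p in E | (2 < deg V E p.1) && (2 < deg V E p.2)].

Definition covers (v : T) (A : {set T * T}) : bool :=
  [forall p in A, (p.1 == v) || (p.2 == v)].

Definition n_colored (K : Type) (col : T -> option K) S : nat :=
  #|[set x in S | isSome (col x)]|.

End Graphs.

(* The forest R(F): disjoint union of all trunks.  A vertex of R(F) is a
   pair (R, x) with R = (S, D) a trunk and x \in S; so a colored vertex
   lying in several trunks appears as a separate copy in each. *)

Definition Rtype (T : finType) : finType :=
  (({set T} * {set T * T}) * T)%type.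

Section Reduction.
Variables (T : finType) (K : Type).
Variables (V : {set T}) (E : {set T * T}) (col : T -> option K).

Definition R_V : {set Rtype T} :=
  [set x : Rtype T | is_trunk V E col x.1.1 x.1.2 && (x.2 \in x.1.1)].

Definition R_E : {set Rtype T * Rtype T} :=
  [set p : Rtype T * Rtype T |
     [&& p.1.1 == p.2.1, is_trunk V E col p.1.1.1 p.1.1.2 &
         (p.1.2, p.2.2) \in p.1.1.2]].

Definition R_col : Rtype T -> option K := fun x => col x.2.

Definition R'_V : {set Rtype T} := R_V.
Definition R'_E : {set Rtype T * Rtype T} :=
  R_E :&: E_gt2 R_V R_E.
Definition R'_col : Rtype T -> option K := R_col.

End Reduction.

Definition edges_of (T : finType) (e : rel T) : {set T * T} :=
  [set p | e p.1 p.2].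

Definition color_one (T : finType) (K : Type) (b : T) (alpha : K) :
  T -> option K := fun x => if x == b then Some alpha else None.

Definition trunk_hyp (T : finType) (e : rel T) (b : T) (alpha : 'I_3) : Prop :=
  let V := [set: T] in
  let E := edges_of e in
  let c := color_one b alpha in
  let V' := R'_V V E c in
  let E' := R'_E V E c in
  let c' := R'_col c in
  exists (S : {set Rtype T}) (D : {set Rtype T * Rtype T}),
    is_trunk V' E' c' S D /\
    (
      (n_colored c' S = 1 /\ exists p, p \in D /\ p \in E_ggt2 V' E')
    \/
      (n_colored c' S = 0 /\ forall v, v \in S -> ~~ covers v (E_ggt2 S D))).

(* Main.v *)
(** Upper bound: eliminate leaves to order the vertices so that each has at most
    one later neighbor, its parent. Call a vertex active if it lies on the chain
    of parents of a colored vertex. Alice keeps at most one active child below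
    every uncolored vertex: Bob's move raises this number to two at one uncolored
    vertex at most, and she colors that vertex.

    Lower bound, for [t <= 3] colors: call a vertex big if it has degree at least
    four. If an uncolored big vertex sees two colors and has two free neighbors,
    Alice must color it at once, so Bob can drive her along a path on which no two
    consecutive vertices are small, starting from a colored vertex; when the path
    reaches two consecutive big vertices he wins ([trunk_win]). In case (i) this
    applies directly. In case (ii) a path of the trunk contains two disjoint edges
    between big vertices. If a small vertex separates them, Bob colors it and wins
    on the side that Alice does not touch ([split_win]). Otherwise there is a path
    of four big vertices, and Bob colors a neighbor of its first vertex
    ([four_big_win]). The two or three moves that decide the play around two
    adjacent big vertices are searched by computation. *)

Require Import Defs.
From mathcomp Require Import all_boot.

Set Implicit Arguments.
Unset Strict Implicit.
Unset Printing Implicit Defensive.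

(** [branch] below has no decision procedure; since Bob's lemmas all end in [False], case analysis
    on it stays constructive. *)
Lemma em_False (P : Prop) : (P \/ ~ P -> False) -> False.
Proof. tauto. Qed.

(** * Nonbacktracking walks and branches of a forest *)

Section Walks.
Variables (T : finType) (e : rel T).

(** Only immediate returns are excluded. This local condition is easy to glue, and in a forest it
    already makes all vertices distinct. *)
Fixpoint nbwalk (s : seq T) : bool :=
  if s is x :: s' then
    if s' is y :: s'' then
      [&& e x y, (if s'' is z :: _ then x != z else true) & nbwalk s']
    else true
  else true.

Lemma nbwalk_path x p : nbwalk (x :: p) -> path e x p.
Proof. by elim: p x => //= y p IH x /and3P[-> _ /IH]. Qed.

Lemma nbwalk_tl x s : nbwalk (x :: s) -> nbwalk s.
Proof. by case: s => //= y s /and3P[]. Qed.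

Lemma nbwalk_catl s1 s2 : nbwalk (s1 ++ s2) -> nbwalk s1.
Proof.
elim: s1 => // x [|y s1] IH // /and3P[exy h /IH H]; apply/and3P; split => //.
by case: s1 h {IH H}.
Qed.

Lemma nbwalk_catr s1 s2 : nbwalk (s1 ++ s2) -> nbwalk s2.
Proof. by elim: s1 => // x s1 IH /nbwalk_tl /IH. Qed.

(** The condition inspects three consecutive vertices, so sharing one edge is enough for gluing. *)
Lemma nbwalk_overlap s1 x y s2 :
  nbwalk (s1 ++ [:: x; y]) -> nbwalk (x :: y :: s2) -> nbwalk (s1 ++ x :: y :: s2).
Proof.
elim: s1 => // a s1 IH.
case: s1 IH => [|b s1] IH; first by move=> /and3P[*]; apply/and3P.
move=> /and3P[ab h H2] H3; apply/and3P; split => //; last exact: IH.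
by case: s1 h {IH H2}.
Qed.

Lemma nbwalk_rev s : symmetric e -> nbwalk s -> nbwalk (rev s).
Proof.
move=> sym; elim: s => // x [|y s] IH //= /and3P[exy h H].
have := IH H; rewrite !rev_cons -!cats1 -catA /=.
case: s h H {IH} => [|z s] h H IH; first by rewrite /= sym exy.
move: IH; rewrite rev_cons -!cats1 -!catA /= => IH.
apply: nbwalk_overlap => //=.
move/andP: H => [/= eyz _].
by rewrite sym eyz sym exy eq_sym h.
Qed.

(** In a forest this is the component of [b] once the edge from [a] to [b] is removed. *)
Definition branch a b v := exists p, nbwalk (a :: b :: p) /\ last b p = v.

Lemma branch_refl a b : e a b -> branch a b b.
Proof. by move=> eab; exists [::]; rewrite /= eab. Qed.

Lemma branch_step a b c v : nbwalk [:: a; b; c] -> branch b c v -> branch a b v.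
Proof.
move=> /=/and4P[eab nac ebc _] [p [H <-]]; exists (c :: p); split => //.
by move: H => /=; rewrite eab nac.
Qed.

Section InForest.
Hypotheses (sym : symmetric e) (irr : irreflexive e) (Hf : forest e).

(** The tail is repetition-free by induction. If the head recurs, the stretch in between closes a
    cycle, unless it is empty (a loop) or a single vertex (a return). *)
Lemma nbwalk_uniq s : nbwalk s -> uniq s.
Proof.
elim: s => // x s IH H; have us := IH (nbwalk_tl H).
rewrite /= us andbT; apply/negP => /path.splitPr Hs.
case: Hs us H {IH} => p1 p2 us H.
apply: Hf; exists x, p1.
have pe := nbwalk_path H; move: (pe); rewrite cat_path /= => /and3P[-> -> _].
rewrite !andbT; move: us; rewrite cat_uniq /= => /and3P[-> /norP[-> _] _] /=.
case: p1 pe H => [|y [|z p1]] //=.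
  by rewrite irr.
by rewrite eqxx andbF.
Qed.

Lemma nbwalk_acyclic x y z p : nbwalk (x :: y :: z :: p) -> ~~ e (last z p) x.
Proof.
move=> H; apply/negP => ex; apply: Hf; exists x, (y :: z :: p).
by rewrite (nbwalk_uniq H) (nbwalk_path H) /= ex.
Qed.

Lemma branch_neq a b v : branch a b v -> v <> a.
Proof.
case=> p [/nbwalk_uniq /= /andP[+ _] <-] E.
by rewrite -E mem_last.
Qed.

Lemma branch_step_neq a b c v : nbwalk [:: a; b; c] -> branch b c v -> v <> a.
Proof.
move=> /=/and4P[eab nac ebc _] [p [H <-]] E.
have: nbwalk [:: a, b, c & p] by move: H => /=; rewrite eab nac.
by move/nbwalk_uniq => /= /andP[]; rewrite -E in_cons mem_last orbT.
Qed.

Lemma branch_nadj a b v : branch a b v -> v <> b -> ~~ e v a.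
Proof.
case=> [[|c p]] [H <-] // _; exact: nbwalk_acyclic H.
Qed.

Lemma branch_step_nadj a b c v : nbwalk [:: a; b; c] -> branch b c v -> ~~ e v a.
Proof.
move=> /=/and4P[eab nac ebc _] [p [H <-]].
have: nbwalk [:: a, b, c & p] by move: H => /=; rewrite eab nac.
exact: nbwalk_acyclic.
Qed.

Lemma branch_adj a b v w : branch a b v -> e v w -> w <> a -> branch a b w.
Proof.
case=> p; elim/last_ind: p => [|p z IH] [H E] evw wa.
  exists [:: w]; split => //; move: H E evw => /=; rewrite !andbT => -> -> ->.
  by rewrite eq_sym; move/eqP: wa => ->.
rewrite last_rcons in E; rewrite {z}E in H.
(* Either [w] is the previous vertex of the walk, which is then shortened, or the walk extends to
   [w]. *)
have [E|/eqP wn] := eqVneq w (last b p).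
  exists p; split => //; move: H; rewrite -cats1 => {IH}.
  by rewrite -!cat_cons => /nbwalk_catl.
exists (rcons (rcons p v) w); rewrite last_rcons; split => //.
have E2 q : [:: a, b & p ++ q] = belast a (b :: p) ++ last b p :: q.
  by rewrite -cat_rcons -[rcons _ _](lastI a (b :: p)).
move: H; rewrite -!cats1 -catA !E2 => H; apply: nbwalk_overlap => //.
move/nbwalk_catr: H => /= /andP[-> _]; rewrite evw !andbT /=.
by apply/eqP => /esym.
Qed.

(** Reversing one walk and gluing it to the other through [v] would give a nonbacktracking walk that
    visits [w] twice. *)
Lemma branch_disj v l r w : l <> r -> branch v l w -> branch v r w -> False.
Proof.
move=> lr [p [Hp Ep]] [q [Hq Eq]].
have H1 : nbwalk [:: l, v, r & q].
  move: Hq Hp => /= /and3P[-> -> ->] /andP[evl _].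
  by rewrite sym evl; move/eqP: lr => ->.
have H : nbwalk (rev p ++ [:: l, v, r & q]).
  apply: nbwalk_overlap H1.
  by move: (nbwalk_rev sym Hp); rewrite !rev_cons -!cats1 -catA.
have := nbwalk_uniq H.
rewrite -[l :: _]cat1s catA cat_uniq => /and3P[_ /negP nh _]; apply: nh.
apply/hasP; exists w; first by rewrite -Eq in_cons mem_last orbT.
by rewrite /= cats1 -rev_cons mem_rev -Ep mem_last.
Qed.

End InForest.
End Walks.

(** * Checking Bob's local strategies by computation *)

(* [vm_compute] is strict, so [has], [all], [&&] and [||] would not short-circuit. *)
Fixpoint lazy_has (A : Type) (p : A -> bool) (s : seq A) :=
  if s is x :: s' then if p x then true else lazy_has p s' else false.

Fixpoint lazy_all (A : Type) (p : A -> bool) (s : seq A) :=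
  if s is x :: s' then if p x then lazy_all p s' else false else true.

Lemma lazy_hasE A (p : A -> bool) s : lazy_has p s = has p s.
Proof. by elim: s => //= x s ->. Qed.

Lemma lazy_allE A (p : A -> bool) s : lazy_all p s = all p s.
Proof. by elim: s => //= x s ->. Qed.

(* A vertex of the local position: whether it is colored, and, for each of three
   colors, whether that color occurs on a neighbor. *)
Definition node := (bool * seq bool)%type.

(* Positions live on a double star: vertices 0 and 1 are the adjacent centers,
   2, ..., m+1 the leaves at 0 and the remaining vertices the leaves at 1. *)
Section Position.
Variable m : nat.
Implicit Types (st : seq node).

Definition star_parent i := if i < m.+2 then 0 else 1.
Definition star_adj i j :=
  ((0 < i) && (star_parent i == j)) || ((0 < j) && (star_parent j == i)).

Definition lookup st i := nth (true, [::]) st i.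
Definition add_color k (s : seq bool) :=
  [seq (if i == k then true else nth false s i) | i <- iota 0 3].

Definition play st (mv : nat * nat) :=
  mkseq (fun j => let n := lookup st j in
     (if j == mv.1 then true else n.1,
      if star_adj mv.1 j then add_color mv.2 n.2 else n.2)) (size st).
(* The effect of coloring a vertex outside the double star; being in a forest, it
   has at most one neighbor in the star. *)
Definition outer st (mv : nat * nat) :=
  mkseq (fun j => let n := lookup st j in
     (n.1, if j == mv.1 then add_color mv.2 n.2 else n.2)) (size st).
Definition legalb st (mv : nat * nat) :=
  let n := lookup st mv.1 in if n.1 then false else ~~ nth true n.2 mv.2.
Definition moves st := [seq (i, k) | i <- iota 0 (size st), k <- iota 0 3].
Definition stuck st :=
  lazy_has (fun n : node => if n.1 then false else lazy_all id n.2) st.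

(** Beyond stuck positions, the three tests cover Alice's replies far from the star, next to it and
    inside it. The outer replies are tested without regard to legality, which only makes the check
    stricter. *)
Definition reply_all (ok : pred (nat * nat)) (P : pred (seq node)) st :=
  if stuck st then true else
  if P st then
    if lazy_all (fun mv => P (outer st mv)) (moves st)
    then lazy_all (fun mv => if legalb st mv then
                               if ok mv then P (play st mv) else true
                             else true) (moves st)
    else false
  else false.

(** Bob wins at once: some uncolored vertex lacks only the color [k], and [k] can be put on a
    neighbor of it. *)
Definition threat st :=
  if stuck st then true else
  lazy_has (fun i => let n := lookup st i in
    if n.1 then false else
    lazy_has (fun k =>
      if lazy_all (fun k' => if k' == k then true else nth false n.2 k') (iota 0 3)
      then lazy_has (fun j => if star_adj j i then legalb st (j, k) else false)
             (iota 0 (size st))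
      else false) (iota 0 3)) (iota 0 (size st)).

(** Only moves that create a threat are tried for Bob, which keeps the search small; Alice's answers
    are not restricted. *)
Fixpoint forced_win n st :=
  if n is n'.+1 then
    if threat st then true else
    lazy_has (fun mv => if legalb st mv then
                let st' := play st mv in
                if threat st' then reply_all predT (forced_win n') st' else false
              else false) (moves st)
  else threat st.

(** The opening move may be one without a threat, provided it is among the candidates [mvs]. *)
Definition quiet_win n mvs st :=
  if forced_win n st then true else
  lazy_has (fun mv => if legalb st mv then
    reply_all predT (forced_win n) (play st mv) else false) mvs.

(** After Bob puts [k] on center 1, every reply other than a move on center 0 loses. *)
Definition forcing n st k :=
  if legalb st (1, k) then
    reply_all (fun mv => mv.1 != 0) (forced_win n) (play st (1, k))
  else false.

End Position.

(* Colors [k >= t] count as seen everywhere, which makes the games with one, two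
   and three colors instances of the same computation. *)
Definition palette (t : nat) (s : seq nat) := [seq (t <= k) || (k \in s) | k <- iota 0 3].
Definition free_node t s : node := (false, palette t s).
Definition leafmasks t k (bs : seq bool) :=
  [seq free_node t (if b then [:: k] else [::]) | b <- bs].
(** The masks with at most one [true]: in a forest, a vertex outside the star is adjacent to at most
    one leaf. *)
Definition one_hot n := nseq n false ::
  [seq set_nth false (nseq n false) i true | i <- iota 0 n].


(** Center 0 has leaves 2 and 3, center 1 has leaves 4, 5 and 6. The quiet candidates put [a], the
    color seen by center 0, on a leaf of center 1; two are listed because one of these leaves may
    see [a]. *)
Lemma broom_check : lazy_all (fun t => lazy_all (fun a => lazy_all (fun k =>
  lazy_all (fun bs => quiet_win 2 1 [:: (4, a); (5, a)]
    (free_node t [:: a] :: free_node t [::] :: leafmasks t k bs))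
  (one_hot 5)) (iota 0 t)) (iota 0 t)) (iota 1 3).
Proof. by vm_compute. Qed.

(** Each center sees one color and has two leaves that see none; the two colors may agree or
    differ. *)
Lemma two_sided_check : lazy_all (fun t => lazy_all (fun a => lazy_all (fun k =>
  forced_win 2 2 (free_node t [:: a] :: free_node t [:: k] ::
                  leafmasks t 0 (nseq 4 false)))
  (iota 0 t)) (iota 0 t)) (iota 1 3).
Proof. by vm_compute. Qed.

(** Center 1 is given no leaves: whatever lies beyond it counts as outside the star. *)
Lemma forcing_check : lazy_all (fun t => lazy_all (fun a => lazy_all (fun k =>
  lazy_all (fun bs => lazy_has (forcing 2 1
    (free_node t [:: a] :: free_node t [::] :: leafmasks t k bs)) (iota 0 t))
  (one_hot 2)) (iota 0 t)) (iota 0 t)) (iota 2 2).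
Proof. by vm_compute. Qed.

(** * Soundness of the local search for the game on the forest *)

Section GameMoves.
Variables (T : finType) (e : rel T) (t : nat).
Implicit Types (c : pcol T t).

Lemma alice_not_blocked b c : alice_wins e b c -> ~ blocked e c.
Proof. by case=> // _ c' H [v [Hv _]]; case: (H v). Qed.

Lemma bob_move c v a : alice_wins e false c -> legal e c v a ->
  alice_wins e true (upd c v a).
Proof.
move=> H lva; inversion H as [? ? A| |? _ _ M]; first by case: (A v (proj1 lva)).
exact: M.
Qed.

Lemma alice_move c v : alice_wins e true c -> c v = None ->
  exists u a, legal e c u a /\ alice_wins e false (upd c u a).
Proof.
by move=> H cv; inversion H as [? ? A|? _ _ M|] => //; case: (A v cv).
Qed.

Lemma updE c v a x : upd c v a x = if x == v then Some a else c x.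
Proof. by rewrite ffunE. Qed.

Definition seen c x :=
  [seq (t <= k) || [exists y, e x y && (omap (@nat_of_ord t) (c y) == Some k)]
  | k <- iota 0 3].

Definition node_of c x : node := (c x != None, seen c x).

Lemma nth_mask P k d : k < 3 -> nth d [seq P i | i <- iota 0 3] k = P k :> bool.
Proof. by case: k => [|[|[|]]]. Qed.

Lemma nth_seen c x d (a : 'I_t) : t <= 3 ->
  nth d (seen c x) a = [exists y, e x y && (c y == Some a)].
Proof.
move=> t3; rewrite /seen nth_mask ?(leq_trans (ltn_ord a)) // leqNgt ltn_ord /=.
apply: eq_existsb => y; congr (_ && _); by case: (c y).
Qed.

Lemma node_of_upd c v a x : c v = None ->
  node_of (upd c v a) x =
  (if x == v then true else (node_of c x).1,
   if e x v then add_color a (seen c x) else seen c x).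
Proof.
move=> cv; rewrite /node_of /seen updE; congr pair; first by case: (x == v).
have E k : [exists y, e x y && (omap (@nat_of_ord t) (upd c v a y) == Some k)] =
  (e x v && (k == a)) || [exists y, e x y && (omap (@nat_of_ord t) (c y) == Some k)].
  apply/existsP/orP => [[y]|[/andP[exv /eqP->]|/existsP[y /andP[exy cy]]]].
  - rewrite updE; case: (y =P v) => [->|_] H; last by right; apply/existsP; exists y.
    by left; move: H => /= /andP[-> /eqP[<-]] /=; rewrite eqxx.
  - by exists v; rewrite updE eqxx exv /=.
  - exists y; rewrite updE exy; case: (y =P v) => // E; by rewrite E cv in cy.
case: ifP => exv; last by apply: eq_map => k; rewrite E exv.
rewrite /add_color; apply/eq_in_map => k; rewrite mem_iota => /andP[_ k3].
by rewrite nth_mask // E exv /=; case: eqP => // _; rewrite orbT.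
Qed.

Lemma stuck_blocked c x : symmetric e -> t <= 3 ->
  c x = None -> all id (seen c x) -> blocked e c.
Proof.
move=> sym t3 cx /allP H; exists x; split=> // a Ha.
have: nth false (seen c x) a.
  by apply: H; apply: mem_nth; rewrite size_map size_iota (leq_trans (ltn_ord a)).
rewrite nth_seen // => /existsP[y /andP[exy /eqP]]; apply: Ha.
by rewrite sym.
Qed.

Section Embedding.
Variables (m : nat) (x0 : T) (f : seq T).
Hypotheses (sym : symmetric e) (t3 : t <= 3) (uf : uniq f).
Hypothesis adjf : forall i j, i < size f -> j < size f ->
  e (nth x0 f i) (nth x0 f j) = star_adj m i j.
Hypothesis outf : forall v i j, v \notin f -> i < size f -> j < size f ->
  e v (nth x0 f i) -> e v (nth x0 f j) -> i = j.

Definition position c := [seq node_of c x | x <- f].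

Lemma lookup_position c i : i < size f ->
  lookup (position c) i = node_of c (nth x0 f i).
Proof. by move=> H; rewrite /lookup (nth_map x0). Qed.

Lemma eq_position c st : size st = size f ->
  (forall i, i < size f -> lookup st i = node_of c (nth x0 f i)) -> position c = st.
Proof.
move=> E H; apply: (@eq_from_nth _ (true, [::])); first by rewrite size_map E.
by move=> i; rewrite size_map => Hi; rewrite (nth_map x0) // -H.
Qed.

Lemma position_play c i a : i < size f -> c (nth x0 f i) = None ->
  position (upd c (nth x0 f i) a) = play m (position c) (i, nat_of_ord a).
Proof.
move=> Hi ci; apply: eq_position => [|j Hj]; first by rewrite size_mkseq size_map.
rewrite /lookup nth_mkseq ?size_map // -/(lookup _ j) lookup_position //=.
by rewrite node_of_upd // nth_uniq // sym adjf.
Qed.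

Lemma position_outer c v a : v \notin f -> c v = None ->
  position (upd c v a) = position c \/
  exists2 i, i < size f &
    position (upd c v a) = outer (position c) (i, nat_of_ord a).
Proof.
move=> vf cv; have vn j : j < size f -> (nth x0 f j == v) = false.
  by move=> Hj; apply: contraNF vf => /eqP <-; rewrite mem_nth.
case: (pickP (fun i : 'I_(size f) => e v (nth x0 f i))) => [i ei|H]; [right|left].
  exists (nat_of_ord i) => //.
  apply: eq_position => [|j Hj]; first by rewrite size_mkseq size_map.
  rewrite /lookup nth_mkseq ?size_map // -/(lookup _ j) lookup_position //=.
  rewrite node_of_upd // vn // sym; congr pair.
  have [->|/eqP ji] := eqVneq j i; first by rewrite ei.
  by case: ifP => // ej; case: ji; apply: outf ej ei.
apply: eq_position => [|j Hj]; first by rewrite size_map.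
rewrite lookup_position // node_of_upd // vn // sym (H (Ordinal Hj)).
by [].
Qed.

Lemma legalb_legal c mv : legalb (position c) mv ->
  exists2 a : 'I_t, mv.2 = a & mv.1 < size f /\ legal e c (nth x0 f mv.1) a.
Proof.
case: mv => i k; rewrite /legalb /=.
(* By the default values, an index out of range reads as a colored vertex and a color beyond the
   list as seen, so the test fails on both. *)
have [Hi|Hi] := ltnP i (size f); last by rewrite /lookup nth_default // size_map.
rewrite lookup_position //=; case: eqP => //= ci.
have [k3|k3] := ltnP k 3; last by rewrite nth_default // size_map size_iota.
have [tk|kt] := leqP t k; first by rewrite /seen nth_mask // tk.
rewrite -[k]/(nat_of_ord (Ordinal kt)) nth_seen // => /existsPn H.
exists (Ordinal kt) => //; split=> //; split=> // u eu cu.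
by move: (H u); rewrite sym eu cu eqxx.
Qed.

Lemma legal_legalb c i a : i < size f -> legal e c (nth x0 f i) a ->
  legalb (position c) (i, nat_of_ord a).
Proof.
move=> Hi [ci av]; rewrite /legalb lookup_position //= ci /=.
rewrite nth_seen //; apply/existsPn => y; apply/negP => /andP[ey /eqP].
by apply: av; rewrite sym.
Qed.

Lemma mem_moves c i (a : 'I_t) : i < size f -> (i, nat_of_ord a) \in moves (position c).
Proof.
move=> Hi; apply/allpairsP; exists (i, nat_of_ord a).
by rewrite !mem_iota size_map /= Hi (leq_trans (ltn_ord a)).
Qed.

Lemma stuck_sound b c : stuck (position c) -> ~ alice_wins e b c.
Proof.
rewrite /stuck lazy_hasE => /(has_nthP (true, [::]))[i].
rewrite size_map => Hi; rewrite -/(lookup _ i) lookup_position //.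
case: ifP => // /negbFE/eqP ci; rewrite lazy_allE => H.
by move/alice_not_blocked; apply; apply: stuck_blocked H.
Qed.

(* Alice's replies that fail the test [ok] are left unrefuted. *)
Lemma reply_sound ok (P : pred (seq node)) c :
  (forall c', P (position c') -> ~ alice_wins e false c') ->
  reply_all m ok P (position c) -> alice_wins e true c ->
  exists i a, [/\ i < size f, ~~ ok (i, nat_of_ord a), legal e c (nth x0 f i) a &
    alice_wins e false (upd c (nth x0 f i) a)].
Proof.
move=> HP; rewrite /reply_all; case: ifP => [/stuck_sound H _ /H //|_].
case: ifP => // Hst; rewrite !lazy_allE; case: allP => // Hout Hplay Hc.
have [[z cz]|all_c] : (exists z, c z = None) \/ all_colored c.
  case: (pickP (fun z => c z == None)) => [z /eqP|H]; first by left; exists z.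
  by right=> z cz; move: (H z); rewrite cz eqxx.
  have [v [a [[cv av] Hv]]] := alice_move Hc cz.
  have [/(nthP x0)[i Hi E]|vf] := boolP (v \in f).
    exists i, a; rewrite E; split => //; apply/negP => Hok.
    move: Hplay => /allP/(_ _ (mem_moves c a Hi)).
    rewrite legal_legalb ?E // Hok -position_play ?E // => /HP; exact.
  case: (position_outer a vf cv) => [E|[i Hi E]].
    by case: (HP _ _ Hv); rewrite E.
  by case: (HP _ _ Hv); rewrite E; apply: Hout; apply: mem_moves.
(* On a fully colored board Alice has won whoever is to move, which contradicts [P]. *)
by case: (HP _ Hst); apply: aw_done.
Qed.

Lemma threat_sound c : threat m (position c) -> ~ alice_wins e false c.
Proof.
rewrite /threat; case: ifP => [/stuck_sound H _|_]; first exact: H.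
rewrite lazy_hasE => /hasP; case=> i; rewrite mem_iota add0n size_map => Hi.
rewrite lookup_position //; case: ifP => // ci.
rewrite lazy_hasE => /hasP; case=> k; rewrite mem_iota => k3.
case: ifP => //; rewrite lazy_allE => /allP Hk.
rewrite lazy_hasE => /hasP; case=> j; rewrite mem_iota add0n ?size_map => Hj.
case: ifP => // ji /legalb_legal[a /= ka [_ lj]] Hc.
have Ha := bob_move Hc lj.
apply: (stuck_sound _ Ha); rewrite position_play ?(proj1 lj) //.
rewrite /stuck lazy_hasE; apply/(has_nthP (true, [::])); exists i.
  by rewrite size_mkseq size_map.
rewrite nth_mkseq ?size_map // lookup_position //=; move: ci => /= ->.
have -> : (i == j) = false.
  apply: contraTF ji => /eqP ->; rewrite /star_adj /star_parent.
  by case: j {Hj lj Ha} => [|[|j]] //=; case: ifP.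
rewrite ji lazy_allE; apply/allP => b /mapP[k']; rewrite -ka mem_iota => k3i ->.
by have := Hk k'; rewrite mem_iota k3i; case: eqP => // _; apply.
Qed.

Lemma forced_win_sound n c : forced_win m n (position c) -> ~ alice_wins e false c.
Proof.
elim: n c => [|n IH] c /=; first exact: threat_sound.
case: ifP => [/threat_sound H _|_]; first exact: H.
rewrite lazy_hasE => /hasP; case=> [[i k] _].
case: ifP => // /legalb_legal[a /= -> [Hi li]].
rewrite -position_play ?(proj1 li) //; case: ifP => // _ H Hc.
by have [? [? []]] := reply_sound IH H (bob_move Hc li).
Qed.

Lemma quiet_win_sound n mvs c :
  quiet_win m n mvs (position c) -> ~ alice_wins e false c.
Proof.
rewrite /quiet_win; case: ifP => [/forced_win_sound H _|_]; first exact: H.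
rewrite lazy_hasE => /hasP; case=> [[i k] _].
case: ifP => // /legalb_legal[a /= -> [Hi li]].
rewrite -position_play ?(proj1 li) // => H Hc.
by have [? [? []]] := reply_sound (@forced_win_sound n) H (bob_move Hc li).
Qed.

Lemma forcing_sound n k c : forcing m n (position c) k -> alice_wins e false c ->
  exists a b : 'I_t, let c' := upd c (nth x0 f 1) a in
  [/\ legal e c (nth x0 f 1) a, legal e c' (nth x0 f 0) b &
      alice_wins e false (upd c' (nth x0 f 0) b)].
Proof.
rewrite /forcing; case: ifP => // /legalb_legal[a /= -> [Hi li]].
rewrite -position_play ?(proj1 li) // => H Hc.
have [i [b [_ /= + lb Hb]]] := reply_sound (@forced_win_sound n) H (bob_move Hc li).
by rewrite negbK => /eqP E; rewrite E in lb Hb; exists a, b.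
Qed.

End Embedding.
End GameMoves.

Lemma mem_one_hot n (bs : seq bool) : size bs = n ->
  (forall i j, nth false bs i -> nth false bs j -> i = j) -> bs \in one_hot n.
Proof.
move=> sz H; rewrite in_cons; have [Hb|nb] := boolP (has id bs).
  apply/orP; right; have Hf := Hb; rewrite has_find sz in Hf.
  apply/mapP; exists (find id bs); first by rewrite mem_iota.
  have Hi := nth_find false Hb.
  apply: (@eq_from_nth _ false) => [|j Hj].
    by rewrite size_set_nth size_nseq sz; apply/esym/maxn_idPr.
  rewrite nth_set_nth /= nth_nseq if_same.
  case: eqP => [->|ji]; first by rewrite Hi.
  by apply/negbTE/negP => /H/(_ Hi).
apply/orP; left; apply/eqP; rewrite -sz; apply/all_pred1P/allP => b /(hasPn nb).
by case: b.
Qed.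

(** * Double stars embedded in a forest *)

Section Brooms.
Variables (T : finType) (e : rel T).
Hypotheses (sym : symmetric e) (irr : irreflexive e) (Hf : forest e).

(** Where degree three is excluded, this is the same as degree greater than two. *)
Definition big v := 3 < #|[set u | e v u]|.

Lemma extend_nbrs v s k : uniq s -> all (e v) s -> size s + k <= #|[set u | e v u]| ->
  exists s', [/\ size s' = k, uniq (s ++ s') & all (e v) s'].
Proof.
move=> us /allP es kn.
pose r := [seq u <- enum [set u | e v u] | u \notin s].
exists (take k r).
have ur : uniq r by rewrite filter_uniq ?enum_uniq.
split.
- rewrite size_takel // -(leq_add2l (size s)); apply: leq_trans kn _.
  rewrite cardE -(count_predC [in s] (enum _)) -!size_filter leq_add2r.
  apply: uniq_leq_size; first by rewrite filter_uniq ?enum_uniq.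
  by move=> z; rewrite mem_filter => /andP[].
- rewrite cat_uniq us take_uniq // andbT /=; apply/hasPn => z /mem_take.
  by rewrite mem_filter => /andP[].
- by apply/allP => z /mem_take; rewrite mem_filter mem_enum inE => /andP[].
Qed.

Section Broom.
Variables (x y : T) (us ws : seq T).
Hypotheses (uus : uniq (y :: us)) (eus : all (e x) (y :: us)).
Hypotheses (uws : uniq (x :: ws)) (ews : all (e y) (x :: ws)).
(** The order follows the numbering of the local positions: both centers, the leaves at [x], the
    leaves at [y]. *)
Let f := [:: x, y & us ++ ws].
Let m := size us.

Let exy : e x y. Proof. by case/andP: eus. Qed.
Let eyx : e y x. Proof. by case/andP: ews. Qed.
Let eu u : u \in us -> e x u. Proof. by case/andP: eus => _ /allP; apply. Qed.
Let ew w : w \in ws -> e y w. Proof. by case/andP: ews => _ /allP; apply. Qed.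
Let uy u : u \in us -> u != y.
Proof. by case/andP: uus => h _; apply: contraTN => /eqP->. Qed.
Let wx w : w \in ws -> w != x.
Proof. by case/andP: uws => h _; apply: contraTN => /eqP->. Qed.

Lemma broom_uniq : uniq f.
Proof.
have /andP[yu Uu] : (y \notin us) && uniq us by [].
have /andP[xw Uw] : (x \notin ws) && uniq ws by [].
rewrite /f 2!cons_uniq cat_uniq Uu Uw in_cons !mem_cat !negb_or xw yu /= !andbT.
rewrite -!andbA; apply/and4P; split.
- by apply: contraTneq exy => ->; rewrite irr.
- by apply/negP => /eu; rewrite irr.
- by apply/negP => /ew; rewrite irr.
(* A leaf common to both centers would close a triangle. *)
apply/hasPn => w Hw; apply/negP => /= Hu.
have := @nbwalk_acyclic _ e irr Hf x y w [::].
by rewrite /= exy ew // eq_sym wx //= sym eu // => /(_ isT).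
Qed.

Let nthf i : i < size f ->
  [\/ i = 0 /\ nth x f i = x, i = 1 /\ nth x f i = y,
      1 < i < m.+2 /\ nth x f i \in us | m.+2 <= i /\ nth x f i \in ws].
Proof.
case: i => [|[|i]] Hi; [exact: Or41|exact: Or42|].
rewrite /= nth_cat; case: ltnP => H; first by apply: Or43; rewrite mem_nth.
apply: Or44; split; first by [].
by rewrite mem_nth // ltn_subLR // -size_cat.
Qed.

(** These walks inside the star, combined with [nbwalk_acyclic], show both that the star is induced
    and that an outside vertex has at most one neighbor in it. *)
Let broom_walk i j : i < j -> j < size f ->
  exists s, [/\ nbwalk e (nth x f i :: rcons s (nth x f j)),
                {subset s <= f} & nilp s = star_adj m i j].
Proof.
move=> ij Hj; have Hi := ltn_trans ij Hj.
have nij : nth x f i != nth x f j by rewrite nth_uniq ?broom_uniq // ltn_eqF.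
rewrite /star_adj /star_parent.
case: (nthf Hi) ij nij => [] [Ei Fi]; case: (nthf Hj) => [] [Ej Fj];
  rewrite ?Fi ?Fj ?Ei ?Ej //= => ij nij.
- by exists [::]; rewrite /= exy.
- exists [::]; rewrite /= eu //; case/andP: Ej => [H1 H2].
  by rewrite H2 (ltn_trans _ H1).
- exists [:: y]; rewrite /= exy ew //= eq_sym wx // (ltnNge j) Ej /=; split => //.
    by move=> z; rewrite !inE => ->; rewrite orbT.
  by rewrite andbF.
- exists [:: x]; rewrite /= eyx eu //= eq_sym uy //; split => //.
    by move=> z; rewrite !inE => ->.
  by case/andP: Ej => /ltnW/ltn_eqF /= -> ->; rewrite andbF.
- exists [::]; rewrite /= ew // (ltnNge j) Ej /=; split => //.
  by case: (j) Ej.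
- by case/andP: Ei; case: (i) ij.
- exists [:: x]; rewrite /= sym !eu //= nij; split => //.
    by move=> z; rewrite !inE => ->.
  case/andP: Ei => H1 ->; case/andP: Ej => H2 ->.
  by case: i j H1 H2 {ij Hi Hj nij Fi Fj} => [|i] [|j].
- exists [:: x; y]; rewrite /= sym eu // exy ew //= uy // eq_sym wx //; split => //.
    by move=> z; rewrite !inE => /orP[]->; rewrite ?orbT.
  case/andP: Ei => H1 ->; rewrite (ltnNge j) Ej /=.
  by case: i j H1 Ej {ij Hi Hj nij Fi Fj} => [|[|i]] [|j] //=; rewrite andbF.
- by case: (i) Ei ij.
- by case/andP: Ej => _; rewrite ltnNge (leq_trans Ei) // ltnW.
- exists [:: y]; rewrite /= sym !ew //= nij; split => //.
    by move=> z; rewrite !inE => ->; rewrite orbT.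
  rewrite (ltnNge i) Ei (ltnNge j) Ej /=.
  by case: i j Ei Ej {ij Hi Hj nij Fi Fj} => [|[|i]] [|[|j]].
Qed.

Lemma broom_adj i j : i < size f -> j < size f ->
  e (nth x f i) (nth x f j) = star_adj m i j.
Proof.
have gen i' j' : i' < j' -> j' < size f ->
    e (nth x f i') (nth x f j') = star_adj m i' j'.
  move=> ij Hj; have [[|z s] [H _ <-]] := broom_walk ij Hj.
    by move: H => /= /andP[->].
  have := @nbwalk_acyclic _ e irr Hf (nth x f i') z.
  case: s H => [|z' s] H; first by move/(_ _ [::] H); rewrite /= sym => /negbTE.
  by move/(_ _ _ H); rewrite last_rcons /= sym => /negbTE.
move=> Hi Hj; case: (ltngtP i j) => [ij|ji|<-]; first exact: gen.
  by rewrite sym gen // /star_adj orbC.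
rewrite irr /star_adj orbb; case: i {Hi} => [|[|i]] //.
by rewrite /star_parent; case: ifP.
Qed.

Lemma broom_outer v i j : v \notin f -> i < size f -> j < size f ->
  e v (nth x f i) -> e v (nth x f j) -> i = j.
Proof.
have gen i' j' : i' < j' -> v \notin f -> j' < size f ->
    e v (nth x f i') -> e v (nth x f j') -> False.
  move=> ij vf Hj ei ej; have [s [H sf _]] := broom_walk ij Hj.
  have vj : v != nth x f j' by apply: contraNneq vf => ->; rewrite mem_nth.
  case: s H sf => [|z s] H sf.
    have := @nbwalk_acyclic _ e irr Hf v (nth x f i') (nth x f j') [::].
    by rewrite /= ei vj (sym _ v) ej; move: H => /= /andP[-> _] /(_ isT).
  have vz : v != z by apply: contraNneq vf => ->; apply: sf; rewrite mem_head.
  have := @nbwalk_acyclic _ e irr Hf v (nth x f i') z (rcons s (nth x f j')).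
  by rewrite last_rcons (sym _ v) ej /= ei vz; move: H => /= -> /(_ isT).
move=> vf Hi Hj ei ej; case: (ltngtP i j) => // ij; first by case: (gen i j).
by case: (gen j i).
Qed.

End Broom.
End Brooms.

(** * Positions around two adjacent vertices *)

Section Configurations.
Variables (T : finType) (e : rel T).
Hypotheses (sym : symmetric e) (irr : irreflexive e) (Hf : forest e).
Variable t : nat.
Hypothesis t3 : t <= 3.
Implicit Types (c : pcol T t).

(* [B] stands for Alice's opening move, which may lie just outside the trunk. *)
Record clear c z0 x y B : Prop := Clear {
  clear_xy : e x y;
  clear_xz : e x z0;
  clear_zy : z0 != y;
  clear_x : forall u, e x u -> u <> z0 -> c u = None;
  clear_y : forall w, e y w -> c w = None;
  clear_leaf : forall u v, e u v -> e x u \/ e y u -> u <> z0 -> u <> x -> u <> y ->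
    c v <> None -> v = B }.

Lemma ord_bound (a : 'I_t) : t \in iota 1 3.
Proof. by rewrite mem_iota (leq_ltn_trans (leq0n a) (ltn_ord a)). Qed.

Lemma seen_palette c x s :
  (forall k, reflect (exists2 y, e x y & omap (@nat_of_ord t) (c y) = Some k) (k \in s)) ->
  seen e c x = palette t s.
Proof.
move=> H; apply: eq_map => k; congr (_ || _); apply/existsP/H => [[y /andP[exy /eqP E]]|[y exy E]].
  by exists y.
by exists y; rewrite exy E eqxx.
Qed.

Lemma seen_nil c x : (forall y, e x y -> c y = None) -> seen e c x = palette t [::].
Proof. by move=> H; apply: seen_palette => k; right=> -[y /H ->]. Qed.

Lemma seen_one c x z (a : 'I_t) : e x z -> c z = Some a ->
  (forall y, e x y -> y <> z -> c y = None) -> seen e c x = palette t [:: nat_of_ord a].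
Proof.
move=> exz cz H; apply: seen_palette => k; rewrite inE.
apply: (iffP eqP) => [->|[y exy]]; first by exists z; rewrite ?cz.
have [->|/eqP yz] := eqVneq y z; first by rewrite cz => -[].
by rewrite H.
Qed.

(** The only colored vertex that a leaf can see is [B], and [B] is adjacent to at most one leaf;
    hence a single color [k] and a mask from [one_hot]. *)
Lemma clear_position c z0 x y B us ws (a : 'I_t) :
  clear c z0 x y B -> c z0 = Some a ->
  uniq [:: z0, y & us] -> all (e x) (y :: us) ->
  uniq (x :: ws) -> all (e y) (x :: ws) ->
  exists k bs, [/\ k \in iota 0 t, bs \in one_hot (size us + size ws) &
    position e [:: x, y & us ++ ws] c =
    free_node t [:: nat_of_ord a] :: free_node t [::] :: leafmasks t k bs].
Proof.
case=> exy exz zy cx cy cl cz uus eus uws ews.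
have uus' : uniq (y :: us) by case/andP: uus.
have lx l : l \in us ++ ws -> l <> x.
  move=> + E; rewrite {}E mem_cat => /orP[h|]; last by apply/negP; case/andP: uws.
  by move: eus => /= /andP[_ /allP/(_ _ h)]; rewrite irr.
have ly l : l \in us ++ ws -> l <> y.
  move=> + E; rewrite {}E mem_cat => /orP[|h]; first by apply/negP; case/andP: uus'.
  by move: ews => /= /andP[_ /allP/(_ _ h)]; rewrite irr.
have cxN : c x = None by apply: cy; rewrite sym.
have cyN : c y = None by apply: cx => // E; rewrite E eqxx in zy.
have ladj l : l \in us ++ ws -> e x l \/ e y l.
  rewrite mem_cat => /orP[h|h]; [left|right].
    by move: eus => /= /andP[_ /allP]; apply.
  by move: ews => /= /andP[_ /allP]; apply.
have lz l : l \in us ++ ws -> l <> z0.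
  move=> + E; rewrite {}E mem_cat => /orP[h|h].
    by move: uus; rewrite cons_uniq in_cons h orbT.
  by move: ews cz => /= /andP[_ /allP/(_ _ h) /cy ->].
have lN l : l \in us ++ ws -> c l = None.
  by move=> h; case: (ladj l h) => [/cx|/cy] // -> //; apply: lz.
(* If [B] is uncolored, the mask is empty and [a] is merely some color in range. *)
pose k := if c B is Some k then nat_of_ord k else nat_of_ord a.
pose bs := [seq e l B && (c B != None) | l <- us ++ ws].
exists k, bs; split.
- by rewrite mem_iota /= /k; case: (c B).
- apply: mem_one_hot => [|i j]; first by rewrite size_map size_cat.
  have nb i' : nth false bs i' -> [/\ i' < size (us ++ ws), c B <> None &
      e B (nth x (us ++ ws) i')].
    have [Hi|Hi] := ltnP i' (size (us ++ ws)); last first.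
      by rewrite nth_default // size_map.
    by rewrite (nth_map x) // => /andP[h /eqP]; split; rewrite // sym.
  case/nb=> Hi cB ei /nb[Hj _ ej].
  have := @broom_outer _ e sym irr Hf x y us ws uus' eus uws ews B i.+2 j.+2.
  move=> /(_ _ Hi Hj ei ej) => H; suff [//] : i.+2 = j.+2.
  apply: H; apply/negP; rewrite !in_cons => /or3P[/eqP E|/eqP E|/lN //].
    by rewrite E in cB.
  by rewrite E in cB.
rewrite /position /= /node_of cxN cyN /=; congr [:: _, _ & _].
- by congr pair; apply: seen_one exz cz cx.
- by congr pair; apply: seen_nil.
rewrite /leafmasks -map_comp; apply/eq_in_map => l Hl /=.
rewrite lN //; congr pair; apply: seen_palette => j.
have cl' v : e l v -> c v <> None -> v = B.
  by move=> h; apply: cl h _ _ _ _; [apply: ladj|apply: lz|apply: lx|apply: ly].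
apply: (iffP idP).
  case: ifP => // /andP[elB cB]; rewrite inE => /eqP ->; exists B => //.
  by rewrite /k; case: (c B) cB.
case=> v elv Ev; have cv : c v <> None by move=> E; rewrite E in Ev.
have vB := cl' v elv cv; rewrite {}vB in elv Ev cv.
rewrite /k elv /=; move: Ev cv; by case: (c B) => //= b [->]; rewrite mem_head.
Qed.

Lemma clear_stuck1 c z0 x y B : clear c z0 x y B -> c z0 <> None -> t <= 1 -> blocked e c.
Proof.
case=> exy exz zy cx cy cl cz t1; exists x; split; first by apply: cy; rewrite sym.
move=> a Ha; case E: (c z0) cz => [b|//] _; apply: (Ha z0); first by rewrite sym.
rewrite E; congr Some; apply: ord_inj; move: (ltn_ord a) (ltn_ord b).
by move=> /leq_trans/(_ t1) + /leq_trans/(_ t1); rewrite !ltnS !leqn0 => /eqP-> /eqP->.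
Qed.

Lemma two_big_win c z0 x y B : clear c z0 x y B -> c z0 <> None -> big e x -> big e y ->
  ~ alice_wins e false c.
Proof.
move=> Hc; case cz: (c z0) => [a|//] _ bx By.
have [exy exz zy _ _ _] := Hc.
(* Degree four gives [x] two leaves besides [z0] and [y], and gives [y] three besides [x]: the star
   of [broom_check]. *)
have [us [sus uus eus]] : exists us, [/\ size us = 2, uniq ([:: z0; y] ++ us) &
    all (e x) us].
  by apply: (@extend_nbrs _ e x [:: z0; y] 2); rewrite //= ?exz ?exy // inE zy.
have [ws [sws uws ews]] : exists ws, [/\ size ws = 3, uniq ([:: x] ++ ws) &
    all (e y) ws].
  by apply: (@extend_nbrs _ e y [:: x] 3); rewrite //= sym exy.
have [||k [bs [Hk Hbs E]]] := clear_position Hc cz uus _ uws _.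
- by rewrite /= exy.
- by rewrite /= sym exy.
apply: (@quiet_win_sound _ e t (size us) x [:: x, y & us ++ ws] sym t3 _ _ _
  1 [:: (4, nat_of_ord a); (5, nat_of_ord a)]).
- by apply: broom_uniq => //=; rewrite ?exy // 1?sym ?exy //; case/andP: uus.
- apply: broom_adj => //=; rewrite ?exy // 1?sym ?exy //; by case/andP: uus.
- apply: broom_outer => //=; rewrite ?exy // 1?sym ?exy //; by case/andP: uus.
rewrite E sus; have := broom_check; rewrite lazy_allE => /allP/(_ t (ord_bound a)).
rewrite lazy_allE => /allP/(_ a); rewrite mem_iota ltn_ord => /(_ isT).
rewrite lazy_allE => /allP/(_ k Hk); rewrite lazy_allE => /allP; apply.
by rewrite sus sws in Hbs.
Qed.

(* In use [y] has degree two, so that Bob's move on [y] keeps the play going. *)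
Lemma forced_reply c z0 x y B : clear c z0 x y B -> c z0 <> None -> 1 < t -> big e x ->
  alice_wins e false c ->
  exists a b, [/\ legal e c y a, legal e (upd c y a) x b &
    alice_wins e false (upd (upd c y a) x b)].
Proof.
move=> Hc; case cz: (c z0) => [a|//] _ t1 bx.
have [exy exz zy _ _ _] := Hc.
have [us [sus uus eus]] : exists us, [/\ size us = 2, uniq ([:: z0; y] ++ us) &
    all (e x) us].
  by apply: (@extend_nbrs _ e x [:: z0; y] 2); rewrite //= ?exz ?exy // inE zy.
have [|||k [bs [Hk Hbs E]]] := @clear_position _ _ _ _ _ us [::] _ Hc cz uus.
- by rewrite /= exy.
- by [].
- by rewrite /= sym exy.
have := forcing_check; rewrite lazy_allE => /allP/(_ t).
have -> : t \in iota 2 2 by rewrite mem_iota t1.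
move=> /(_ isT).
rewrite lazy_allE => /allP/(_ a); rewrite mem_iota ltn_ord => /(_ isT).
rewrite lazy_allE => /allP/(_ k Hk); rewrite lazy_allE => /allP/(_ bs).
rewrite sus in Hbs; rewrite Hbs => /(_ isT); rewrite lazy_hasE => /hasP; case=> b _.
rewrite -E -sus => Hb.
have := @forcing_sound _ e t (size us) x [:: x, y & us ++ [::]] sym t3 _ _ _ _ _ _ Hb.
apply.
- by apply: broom_uniq => //=; rewrite ?exy // 1?sym ?exy //; case/andP: uus.
- apply: broom_adj => //=; rewrite ?exy // 1?sym ?exy //; by case/andP: uus.
- apply: broom_outer => //=; rewrite ?exy // 1?sym ?exy //; by case/andP: uus.
Qed.

(** The position of [two_sided_check]. It arises when Bob colors a neighbor of one center and Alice
    answers with a neighbor of the other. *)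
Lemma both_sides_win c p q x y : e x y -> e x p -> e y q -> p != y -> q != x ->
  c p <> None -> c q <> None -> big e x -> big e y ->
  (forall u, e x u -> u <> p -> c u = None) -> (forall u, e y u -> u <> q -> c u = None) ->
  (forall u v, e u v -> e x u /\ u <> p \/ e y u /\ u <> q -> u <> x -> u <> y ->
     c v = None) ->
  ~ alice_wins e false c.
Proof.
move=> exy exp eyq py qx; case cp: (c p) => [a|//] _; case cq: (c q) => [b|//] _.
move=> bx By cx cy cl.
have [us [sus uus eus]] : exists us, [/\ size us = 2, uniq ([:: p; y] ++ us) &
    all (e x) us].
  by apply: (@extend_nbrs _ e x [:: p; y] 2); rewrite //= ?exp ?exy // inE py.
have [ws [sws uws ews]] : exists ws, [/\ size ws = 2, uniq ([:: q; x] ++ ws) &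
    all (e y) ws].
  by apply: (@extend_nbrs _ e y [:: q; x] 2); rewrite //= ?eyq 1?sym ?exy // inE qx.
have uus' : uniq (y :: us) by case/andP: uus.
have uws' : uniq (x :: ws) by case/andP: uws.
have eus' : all (e x) (y :: us) by rewrite /= exy.
have ews' : all (e y) (x :: ws) by rewrite /= sym exy.
have cxN : c x = None by apply: cy; rewrite 1?sym //; apply/eqP; rewrite eq_sym.
have cyN : c y = None by apply: cx => //; apply/eqP; rewrite eq_sym.
apply: (@forced_win_sound _ e t (size us) x [:: x, y & us ++ ws] sym t3 _ _ _ 2).
- exact: broom_uniq.
- exact: broom_adj.
- exact: broom_outer.
have E : position e [:: x, y & us ++ ws] c = free_node t [:: nat_of_ord a] ::
    free_node t [:: nat_of_ord b] :: leafmasks t 0 (nseq 4 false).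
  have -> : leafmasks t 0 (nseq 4 false) = [seq free_node t [::] | _ <- us ++ ws].
    case: (us) sus => [|u1 [|u2 []]] // _.
    by case: (ws) sws => [|w1 [|w2 []]].
  rewrite /position /= /node_of cxN cyN /=; congr [:: _, _ & _].
  - by congr pair; apply: seen_one exp cp cx.
  - by congr pair; apply: seen_one eyq cq cy.
  apply/eq_in_map => l.
  have nl (s : seq T) z : uniq (z :: s) -> l \in s -> l <> z.
    by case/andP=> h _ /[swap] ->; apply/negP.
  rewrite mem_cat => /orP[Hl|Hl].
    have exl : e x l by move/allP: eus; apply.
    have lp : l <> p by apply: nl uus _; rewrite in_cons Hl orbT.
    have ly : l <> y by apply: nl uus' _.
    have lx : l <> x by move=> E; rewrite E irr in exl.
    rewrite cx //; congr pair; apply: seen_nil => v lv.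
    by apply: cl lv _ _ _ => //; left.
  have eyl : e y l by move/allP: ews; apply.
  have lq : l <> q by apply: nl uws _; rewrite in_cons Hl orbT.
  have lx : l <> x by apply: nl uws' _.
  have ly : l <> y by move=> E; rewrite E irr in eyl.
  rewrite cy //; congr pair; apply: seen_nil => v lv.
  by apply: cl lv _ _ _ => //; right.
rewrite E sus; have := two_sided_check; rewrite lazy_allE => /allP/(_ t (ord_bound a)).
rewrite lazy_allE => /allP/(_ a); rewrite mem_iota ltn_ord => /(_ isT).
by rewrite lazy_allE => /allP; apply; rewrite mem_iota ltn_ord.
Qed.

End Configurations.

(** * Bob's strategies with at most three colors *)

Section BobStrategy.
Variables (T : finType) (e : rel T).
Hypotheses (sym : symmetric e) (irr : irreflexive e) (Hf : forest e).
Variable t : nat.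
Hypothesis t3 : t <= 3.
Implicit Types (c : pcol T t).

(** The gluing of [branch_disj], now along the edge between [a] and [b] instead of through a
    vertex. *)
Lemma branch_opp a b v : branch e b a v -> branch e a b v -> False.
Proof.
move=> [p [Hp Ep]] [q [Hq Eq]].
have H : nbwalk e (rev p ++ [:: a, b & q]).
  apply: nbwalk_overlap Hq.
  by move: (nbwalk_rev sym Hp); rewrite !rev_cons -!cats1 -catA.
have := nbwalk_uniq irr Hf H.
rewrite -[a :: _]cat1s catA cat_uniq => /and3P[_ /negP nh _]; apply: nh.
apply/hasP; exists v; first by rewrite -Eq mem_last.
by rewrite /= cats1 -rev_cons mem_rev -Ep mem_last.
Qed.

Lemma no_triangle x y z : e x y -> e y z -> x <> z -> ~~ e z x.
Proof.
move=> xy yz /eqP xz; have := @nbwalk_acyclic _ e irr Hf x y z [::].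
by rewrite /= xy yz xz => /(_ isT).
Qed.

Lemma no_square x y z w : e x y -> e y z -> e z w -> x <> z -> y <> w -> ~~ e w x.
Proof.
move=> xy yz zw /eqP xz /eqP yw; have := @nbwalk_acyclic _ e irr Hf x y z [:: w].
by rewrite /= xy yz zw xz yw => /(_ isT).
Qed.

Definition trunk_edge a b := e a b && (big e a || big e b).

Fixpoint has_big_edge z p :=
  if p is y :: p' then (big e z && big e y) || has_big_edge y p' else false.

Lemma has_big_edge_last z p y : big e (last z p) -> big e y -> has_big_edge z (rcons p y).
Proof. by elim: p z => [|x p IH] z bz By /=; rewrite ?bz ?By // IH ?orbT. Qed.

Lemma branch_clear c z0 x y B : nbwalk e [:: z0; x; y] ->
  (forall v, branch e z0 x v -> c v <> None -> [/\ v = B, ~~ e v x & ~~ e v y]) ->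
  clear e c z0 x y B.
Proof.
move=> /[dup] Hw /and4P[zx zy xy _] H.
have bx : branch e z0 x x by exact: branch_refl.
have yx : y <> x by move=> E; rewrite E irr in xy.
have By : branch e z0 x y by apply: branch_adj bx xy _; apply/eqP; rewrite eq_sym.
have bu u : e x u -> u <> z0 -> branch e z0 x u by exact: branch_adj.
have yz w : e y w -> w <> z0.
  by move=> + E; rewrite E; apply/negP; apply: branch_nadj By yx.
have bw w : e y w -> branch e z0 x w.
  by move=> yw; apply: branch_adj By (yw) _; exact: yz yw.
split=> //; first by rewrite sym.
- move=> u xu uz; case cu: (c u) => [k|//].
  by have [|_] := H u (bu _ xu uz); rewrite ?cu // sym xu.
- move=> w yw; case cw: (c w) => [k|//].
  by have [|_ _] := H w (bw _ yw); rewrite ?cw // sym yw.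
move=> u v uv uxy uz ux uy cv.
have Hu : branch e z0 x u by case: uxy => [h|h]; [apply: bu|apply: bw].
have vz : v <> z0.
  by move=> E; move: uv; rewrite E; apply/negP; apply: branch_nadj Hu ux.
by have [] := H v (branch_adj Hu uv vz) cv.
Qed.

(* When [z1 :: z2 :: _] starts with a vertex [z2] of degree two, coloring [z2]
   forces Alice to color [z1], and the same situation recurs two steps further. *)
Lemma trunk_win c z0 z1 ps B :
  c z0 <> None -> e z0 z1 -> path trunk_edge z1 ps -> uniq [:: z0, z1 & ps] ->
  big e z1 -> has_big_edge z1 ps ->
  (forall v, branch e z0 z1 v -> c v <> None ->
     v = B /\ forall z, z \in z1 :: ps -> ~~ e v z) ->
  ~ alice_wins e false c.
Proof.
have [n] := ubnP (size ps); elim: n => // n IH in c z0 z1 ps *.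
case: ps => [|z2 ps] sz cz z01 Hp Hu b1 Hb Hc Hw.
  by [].
have /andP[/andP[e12 b12] Hp2] := Hp.
have w012 : nbwalk e [:: z0; z1; z2].
  rewrite /= z01 e12 !andbT /=; apply/eqP => E.
  by move: Hu; rewrite E cons_uniq !in_cons eqxx orbT.
have cl : clear e c z0 z1 z2 B.
  apply: branch_clear => // v /Hc H /H[-> Hz].
  by split=> //; apply: Hz; rewrite !in_cons eqxx ?orbT.
have [t1|t1] := leqP t 1.
  exact: alice_not_blocked Hw (clear_stuck1 sym cl cz t1).
have [b2|b2] := boolP (big e z2); first exact: (two_big_win sym irr Hf t3 cl).
have [a [b [_ _ Hw']]] := forced_reply sym irr Hf t3 cl cz t1 b1 Hw.
(* As [z2] is small, the edge between big vertices lies further on, so [z3] exists, and it is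
   big. *)
move: Hb; rewrite /= (negbTE b2) andbF /=.
case: ps => [|z3 ps] //= in sz Hp2 Hu Hc Hp *; rewrite (negbTE b2) /= => Hb.
move: Hp2 => /= /andP[/andP[e23 b23] Hp3].
rewrite (negbTE b2) /= in b23.
have [n12 n13] : z1 <> z2 /\ z1 <> z3.
  by case/and3P: Hu => _ + _; rewrite !in_cons !negb_or => /and3P[/eqP ? /eqP ? _].
have w123 : nbwalk e [:: z1; z2; z3] by rewrite /= e12 e23 !andbT; apply/eqP.
(* The play restarts from the colored [z2]. The branch at [z3] contains neither [z1] nor [z2], so no
   new colored vertex appears in it. *)
apply: (IH _ z2 z3 ps) Hw' => //.
- by apply: ltnW; move: sz; rewrite /= ltnS.
- by rewrite !updE eqxx; case: eqP => // E; case: n12.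
- by case/and3P: Hu.
move=> v Hv; rewrite !updE.
have /eqP/negbTE-> := branch_step_neq irr Hf w123 Hv.
have /eqP/negbTE-> := branch_neq irr Hf Hv.
have Hv' : branch e z0 z1 v by apply: branch_step w012 (branch_step w123 Hv).
case/(Hc v Hv') => -> H; split=> // z Hz; apply: H.
by rewrite !in_cons -in_cons Hz !orbT.
Qed.

(* Bob colors the vertex [s] of degree two; Alice's reply lies on one side of it. *)
Lemma split_win c l' l s r ps B (a : 'I_t) :
  path trunk_edge l' [:: l, s, r & ps] -> uniq [:: l', l, s, r & ps] ->
  big e l' -> big e l -> big e r -> has_big_edge r ps ->
  (forall v, c v <> None -> v = B) ->
  (forall z, z \in [:: l', l, s, r & ps] -> c z = None /\ ~~ e B z) ->
  ~ alice_wins e false c.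
Proof.
move=> /= /and4P[t1 t2 t3' tp] Hu bl' bl br Hb Hc Hz Hw.
have [el'l els esr] : [/\ e l' l, e l s & e s r].
  by move: t1 t2 t3' => /andP[-> _] /andP[-> _] /andP[-> _].
have [Hlr Hll'] : l <> r /\ l <> l'.
  move: Hu => /= /and3P[]; rewrite !inE !negb_or => /andP[/eqP h _] /and3P[_ /eqP h2 _] _.
  by split=> // E; case: h.
have [cs sB] : c s = None /\ ~~ e B s by apply: Hz; rewrite !inE eqxx !orbT.
have [cl lB] : c l = None /\ ~~ e B l by apply: Hz; rewrite !inE eqxx !orbT.
have ls : l <> s by move=> E; rewrite E irr in els.
have leg : legal e c s a.
  split=> // u us cu; have uB : u = B by apply: Hc; rewrite cu.
  by rewrite -uB us in sB.
have H1 := bob_move Hw leg.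
have [|v [k [[cv _] H2]]] := @alice_move _ _ _ _ l H1.
  by rewrite updE; case: eqP.
have vs : v <> s by move=> E; rewrite E updE eqxx in cv.
have Bs : c s <> None -> False by rewrite cs.
have Hc2 w : upd (upd c s a) v k w <> None -> w <> v -> w <> s -> w = B.
  rewrite !updE; case: eqP => // _; case: eqP => // _ cw _ _; exact: Hc.
have c2s : upd (upd c s a) v k s <> None.
  by rewrite !updE eqxx; case: eqP.
(* If Alice answered on the side of [l], the path from [r] onwards is untouched; otherwise the path
   from [l] to [l'] is. *)
apply: (@em_False (branch e s l v)) => -[Hl|Hl].
  apply: (@trunk_win _ s r ps B c2s esr tp _ br Hb _ H2); first by case/and3P: Hu.
  move=> w Hr cw; have wB : w = B.
    apply: Hc2 => //; last exact: (branch_neq irr Hf Hr).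
    by move=> E; rewrite E in Hr; apply: branch_disj Hlr Hl Hr.
  split=> // z zr; rewrite wB; case: (Hz z) => //.
  by rewrite 3!in_cons zr !orbT.
have esl : e s l by rewrite sym.
apply: (@trunk_win _ s l [:: l'] B c2s esl _ _ bl _ _ H2).
- by rewrite /= /trunk_edge sym el'l bl.
- rewrite /= !inE andbT; apply/andP; split; last by apply/eqP.
  rewrite negb_or; apply/andP; split; first by apply/eqP => E; case: ls.
  apply/eqP => E; move: Hu; rewrite E /= !inE eqxx !orbT.
  by [].
- by rewrite /= bl bl'.
move=> w Hw' cw; have wB : w = B.
  apply: Hc2 => //; last exact: (branch_neq irr Hf Hw').
  by move=> E; rewrite E in Hw'.
split=> // z; rewrite !inE => zl; rewrite wB; case: (Hz z) => //.
by rewrite !inE; case/orP: zl => ->; rewrite ?orbT.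
Qed.

(** Bob colors a neighbor [p] of [w0]. If Alice answers on [w0] or [w1], [trunk_win] applies to the
    rest of the path; next to [w1], [both_sides_win]; elsewhere beyond [w2], [two_big_win] around
    [w0] and [w1]. After any other answer Bob colors [w1]. Then either the path beyond [w1] is left
    alone and [trunk_win] applies, or Alice neglects [w0], which Bob blocks. *)
Lemma four_big_win c w0 w1 w2 w3 B (a : 'I_t) :
  path e w0 [:: w1; w2; w3] -> uniq [:: w0; w1; w2; w3] ->
  all (big e) [:: w0; w1; w2; w3] ->
  (forall v, c v <> None -> v = B) ->
  (forall z, z \in [:: w0; w1; w2; w3] -> c z = None /\ ~~ e B z) ->
  ~ branch e w2 w1 B -> ~ alice_wins e false c.
Proof.
move=> /and4P[e01 e12 e23 _] Hu /and5P[b0 b1 b2 b3 _] Hc Hz nB Hw.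
have [c0 B0] : c w0 = None /\ ~~ e B w0 by apply: Hz; rewrite !inE eqxx ?orbT.
have [c1 B1] : c w1 = None /\ ~~ e B w1 by apply: Hz; rewrite !inE eqxx ?orbT.
have [c2 B2] : c w2 = None /\ ~~ e B w2 by apply: Hz; rewrite !inE eqxx ?orbT.
have [e10 e21] : e w1 w0 /\ e w2 w1 by rewrite sym e01 sym e12.
have [n01 n02 n12 n13] : [/\ w0 <> w1, w0 <> w2, w1 <> w2 & w1 <> w3].
  by move: Hu; rewrite /= !inE !negb_or => /and4P[/and3P[/eqP ? /eqP ? _] /andP[/eqP ? /eqP ?] _ _].
have w012 : nbwalk e [:: w0; w1; w2].
  by rewrite /= e01 e12 !andbT; apply/eqP.
have b21 : branch e w2 w1 w1 by exact: branch_refl.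
have b20 : branch e w2 w1 w0 by apply: branch_adj b21 e10 _.
(* Such a colored vertex would be [B], which is neither in the branch at [w1] away from [w2] nor
   adjacent to [w2]. *)
have leafB u v : e w0 u \/ e w1 u -> u <> w0 -> u <> w1 -> e u v -> c v <> None -> False.
  move=> uw u0 u1 uv cv; have vB := Hc v cv; rewrite {}vB in uv cv.
  have [u2|/eqP u2] := eqVneq u w2; first by rewrite -u2 sym uv in B2.
  have Hb : branch e w2 w1 u.
    by case: uw => h; [apply: branch_adj b20 h u2|apply: branch_adj b21 h u2].
  apply: nB; apply: branch_adj Hb uv _ => E.
  by rewrite E in cv.
have nbrB u : c u <> None -> e w0 u \/ e w1 u -> False.
  move=> cu; rewrite (Hc u cu) => -[]; rewrite sym; exact/negP.
(* Besides [w1], the big vertex [w0] has three neighbors: [p] for Bob's first move, and [r1], [r2]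
   as candidates for the final block. *)
have [us [sus uus eus]] : exists us, [/\ size us = 3, uniq ([:: w1] ++ us) &
    all (e w0) us].
  by apply: (@extend_nbrs _ e w0 [:: w1] 3); rewrite //= e01.
case: us sus uus eus => [|p [|r1 [|r2 []]]] // _.
rewrite /= !inE !negb_or => /and4P[/and3P[/eqP p1 /eqP r11 /eqP r21]].
move=> /andP[/eqP pr1 /eqP pr2] /eqP r12 _ /and4P[ep er1 er2 _].
have p0 : p <> w0 by move=> E; rewrite E irr in ep.
have p1' : p <> w1 by move=> E; case: p1.
have ep0 : e p w0 by rewrite sym.
have cp : c p = None by case E: (c p) => [k|//]; case: (@nbrB p); rewrite ?E //; left.
have wp01 : nbwalk e [:: p; w0; w1].
  by rewrite /= ep0 e01 !andbT; apply/eqP.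
have leg : legal e c p a.
  by split=> // u us cu; case: (@leafB p u) => //; rewrite ?cu 1?sym //; left.
have H1 := bob_move Hw leg.
have [t1|t1] := leqP t 1.
  apply: (alice_not_blocked H1); exists w0; split.
    by rewrite updE; case: eqP => // E; case: p0.
  move=> k Hk; apply: (Hk p ep0); rewrite updE eqxx; congr Some; apply: ord_inj.
  move: (ltn_ord a) (ltn_ord k).
  by move=> /leq_trans/(_ t1) + /leq_trans/(_ t1); rewrite !ltnS !leqn0 => /eqP-> /eqP->.
have [|v [d [[cv' _] H2]]] := @alice_move _ _ _ _ w0 H1.
  by rewrite updE; case: eqP => // E; case: p0.
set c2' := upd _ v d in H2.
have vp : v <> p by move=> E; rewrite E updE eqxx in cv'.
have vB : c v = None by move: cv'; rewrite updE; case: eqP.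
have col2 w : c2' w <> None -> [\/ w = v, w = p | c w <> None].
  by rewrite /c2' !updE; case: eqP => [|_]; [constructor 1|case: eqP => [|_]; [constructor 2|constructor 3]].
have c2v : c2' v <> None by rewrite /c2' updE eqxx.
have c2p : c2' p <> None by rewrite /c2' !updE eqxx; case: eqP.
have np12 w : branch e w1 w2 w -> w <> p.
  by move=> H; apply: (branch_step_neq irr Hf wp01); apply: branch_step w012 H.
have [E|/eqP v0] := eqVneq v w0.
  rewrite E in c2v; apply: (@trunk_win c2' w0 w1 [:: w2] B) H2 => //.
  - by rewrite /= /trunk_edge e12 b1.
  - by rewrite /= !inE negb_or andbT -andbA; apply/and3P; split; apply/eqP.
  - by rewrite /= b1 b2.
  move=> w Hw'; case/col2 => [wv|wp|/Hc ->].
  - by case: (branch_neq irr Hf Hw'); rewrite wv.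
  - by case: (branch_step_neq irr Hf wp01 Hw').
  by split=> // z; rewrite !inE => /orP[] /eqP->.
have tw c' : alice_wins e false c' -> c' w1 <> None ->
  (forall w, branch e w1 w2 w -> c' w <> None -> w = B) -> False.
  move=> H c1' Hb; apply: (@trunk_win c' w1 w2 [:: w3] B) H => //.
  - by rewrite /= /trunk_edge e23 b2.
  - by case/andP: Hu.
  - by rewrite /= b2 b3.
  move=> w Hw' cw; split; first exact: Hb.
  rewrite (Hb w) // => z zz; case: (Hz z) => //.
  by rewrite 2!in_cons zz !orbT.
have [E|/eqP v1] := eqVneq v w1.
  apply: (tw c2') => //; first by rewrite -E.
  move=> w Hw'; case/col2 => [wv|/(np12 _ Hw')|/Hc] //.
  by case: (branch_neq irr Hf Hw'); rewrite wv.
have [w0N w1N] : c2' w0 = None /\ c2' w1 = None.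
  rewrite /c2' !updE; do !(case: eqP => [E|_]; first by [case: v0|case: v1|case: p0|case: p1']).
  by [].
have pleaf u : e w0 u \/ e w1 u -> u <> p -> u <> w0 -> u <> w1 -> ~~ e u p.
  move=> uw up u0 u1; case: uw => h.
    by apply: no_triangle ep0 h _ => E; case: up.
  by apply: no_square ep0 e01 h _ _ => // E; case: u0.
have np1 : ~~ e w1 p by apply: no_triangle ep0 e01 _.
have [ev1|ev1] := boolP (e w1 v).
  apply: (@both_sides_win _ e sym irr Hf t t3 c2' p v w0 w1) H2 => //.
  - by apply/eqP.
  - by apply/eqP.
  - move=> u eu up; case E: (c2' u) => [k|//].
    have: c2' u <> None by rewrite E.
    case/col2 => // [uv|cu]; last by case: (nbrB u cu); left.
    have := no_triangle e01 ev1 _; rewrite -uv sym eu => H.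
    by suff: false by []; apply: H => E2; case: v0; rewrite -uv.
  - move=> u eu up; case E: (c2' u) => [k|//].
    have: c2' u <> None by rewrite E.
    case/col2 => // [uv|cu]; last by case: (nbrB u cu); right.
    by rewrite -uv eu in np1.
  move=> u w uw Hu' u0 u1; case E: (c2' w) => [k|//].
  have: c2' w <> None by rewrite E.
  have ua : e w0 u \/ e w1 u by case: Hu' => -[]; [left|right].
  case/col2 => [wv|wp|cw]; last by case: (leafB u w).
  - rewrite {}wv in uw; case: Hu' => -[h1 h2].
      have := no_square (_ : e v w1) e10 h1; rewrite uw sym ev1.
      by move/(_ isT) => H; suff: false by []; apply: H => // E2; case: u1.
    have := no_triangle (_ : e v w1) h1; rewrite uw sym ev1.
    by move/(_ isT) => H; suff: false by []; apply: H => // E2; case: h2.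
  rewrite {}wp in uw; suff: ~~ e u p by rewrite uw.
  apply: pleaf => // up; case: Hu' => -[] // h _.
  by rewrite -up h in np1.
apply: (@em_False (branch e w1 w2 v)) => -[Hv|Hv].
  apply: (@two_big_win _ e sym irr Hf t t3 c2' p w0 w1 v _ c2p b0 b1) H2.
  split=> //; first by apply/eqP.
  - move=> u eu up; case E: (c2' u) => [k|//].
    have: c2' u <> None by rewrite E.
    case/col2 => // [uv|cu]; last by case: (nbrB u cu); left.
    by have := branch_step_nadj irr Hf w012 Hv; rewrite -uv sym eu.
  - move=> u eu; case E: (c2' u) => [k|//].
    have: c2' u <> None by rewrite E.
    case/col2 => // [uv|up|cu]; last by case: (nbrB u cu); right.
      by rewrite -uv eu in ev1.
    by rewrite -up eu in np1.
  move=> u w uw ua up u0 u1; case/col2 => // [wp|cw]; last by case: (leafB u w).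
  by have := pleaf u ua up u0 u1; rewrite -wp uw.
have [b ba] : exists b : 'I_t, b != a.
  have [k ka|H] := pickP (fun b : 'I_t => b != a); first by exists k.
  have := H (Ordinal (ltnW t1)); have := H (Ordinal t1).
  by move=> /negbFE/eqP <- /negbFE/eqP.
(* Coloring [w1] threatens [w0], so Alice has no time to play beyond [w1]. *)
have leg1 : legal e c2' w1 b.
  split=> // u us cu; have: c2' u <> None by rewrite cu.
  rewrite sym in us; case/col2 => [uv|up|cu']; last by case: (nbrB u cu'); right.
    by rewrite -uv us in ev1.
  by rewrite -up us in np1.
have H3 := bob_move H2 leg1; set c3 := upd _ w1 b in H3.
have [|v2 [d2 [[cv2 _] H4]]] := @alice_move _ _ _ _ w0 H3.
  by rewrite /c3 updE; case: eqP.
have v2N : c2' v2 = None /\ v2 <> w1.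
  by move: cv2; rewrite /c3 updE; case: eqP.
set c4 := upd _ v2 d2 in H4.
have col4 w : c4 w <> None -> w = v2 \/ w = w1 \/ c2' w <> None.
  rewrite /c4 updE; case: eqP => [->|_]; first by left.
  by rewrite /c3 updE; case: eqP => [->|_]; right; [left|right].
apply: (@em_False (branch e w1 w2 v2)) => -[Hv2|Hv2]; last first.
  apply: (tw c4) => //.
    by rewrite /c4 /c3 !updE eqxx; case: eqP => // E; case: v2N.
  move=> w Hw'; case/col4 => [E|[E|]]; first by rewrite E in Hw'.
    by case: (branch_neq irr Hf Hw').
  by case/col2 => [E|/(np12 _ Hw')|/Hc] //; rewrite E in Hw'.
have v20 : v2 <> w0 by exact: (branch_step_neq irr Hf w012 Hv2).
(* By acyclicity [v] is equal or adjacent to at most one of [r1] and [r2]; the other one accepts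
   every color. *)
have [r [er rp [rv erv] rw1]] : exists r, [/\ e w0 r, r <> p, r <> v /\ ~~ e r v & r <> w1].
  have key r r' : e w0 r -> e w0 r' -> r <> r' -> r = v \/ e r v -> r' <> v /\ ~~ e r' v.
    move=> h h' rr [rv|erv].
      split; first by move=> E; case: rr; rewrite rv.
      by rewrite -rv; apply: no_triangle h' _ => //; rewrite sym.
    split.
      move=> E; rewrite -E in erv.
      have := no_triangle (_ : e r w0) h'; rewrite sym h => /(_ isT rr).
      by rewrite sym erv.
    rewrite sym; have := no_square (_ : e v r) (_ : e r w0) h'.
    rewrite sym erv sym h => /(_ isT isT v0 rr).
    by rewrite sym.
  have [/orP H|/norP[/eqP ? ?]] := boolP ((r1 == v) || e r1 v).
    exists r2; split=> //; [by move=> E; case: pr2|apply: (key r1) => //|by move=> E; case: r21].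
    by case: H => [/eqP|]; [left|right].
  by exists r1; split=> // E; [case: pr1|case: r11].
have r0 : r <> w0 by move=> E; rewrite E irr in er.
have v2r0 : ~~ e v2 w0 by exact: (branch_step_nadj irr Hf w012 Hv2).
have rv2 : ~~ e r v2.
  apply/negP => h; have: branch e w1 w2 r by apply: branch_adj Hv2 _ _; rewrite // sym.
  by move/(branch_step_nadj irr Hf w012); rewrite sym er.
have rN : c4 r = None.
  case E: (c4 r) => [k|//]; have: c4 r <> None by rewrite E.
  case/col4 => [h|[h|/col2[]]] //.
    by rewrite -h sym er in v2r0.
  by move=> cr; case: (nbrB r cr); left.
have rleg k : legal e c4 r k.
  split=> // u; rewrite sym => ru cu; have: c4 u <> None by rewrite cu.
  case/col4 => [h|[h|/col2[h|h|h]]].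
  - by rewrite -h ru in rv2.
  - have := no_triangle e10 er; rewrite -h ru => H.
    by suff: false by []; apply: H => E; case: rw1; rewrite -h E.
  - by rewrite -h ru in erv.
  - by have := pleaf r (or_introl er) rp r0 rw1; rewrite -h ru.
  by case: (leafB r u) => //; left.
have c4w0 : c4 w0 = None.
  rewrite /c4 updE; case: eqP => [E|_]; first by case: v20.
  by rewrite /c3 updE; case: eqP.
have c4p : c4 p = Some a.
  rewrite /c4 /c3 updE; case: eqP => [E|_].
    by case: v2N => + _; rewrite -E => h; rewrite h in c2p.
  rewrite updE; case: eqP => // _; rewrite /c2' updE; case: eqP => [E|_]; first by case: vp.
  by rewrite updE eqxx.
have c4w1 : c4 w1 = Some b.
  rewrite /c4 updE; case: eqP => [E|_]; first by case: v2N => _ [].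
  by rewrite /c3 updE eqxx.
have [g /andP[ga gb]|H] := pickP (fun g : 'I_t => (g != a) && (g != b)); last first.
  apply: (alice_not_blocked H4); exists w0; split=> // k Hk.
  move: (H k); have [E|ka] := eqVneq k a; first by case: (Hk p ep0); rewrite E.
  have [E|//] := eqVneq k b; by case: (Hk w1 e10); rewrite E.
have H5 := bob_move H4 (rleg g).
apply: (alice_not_blocked H5); exists w0; split.
  by rewrite updE; case: eqP => // E; case: r0.
move=> k Hk; have kr : k != g.
  apply/eqP => E; apply: (Hk r); first by rewrite sym.
  by rewrite updE eqxx E.
have upd4 w : w <> r -> upd c4 r g w = c4 w by rewrite updE; case: eqP.
have ka : k != a.
  by apply/eqP => E; apply: (Hk p ep0); rewrite upd4 ?E // => E2; case: rp.
have kb : k != b.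
  by apply/eqP => E; apply: (Hk w1 e10); rewrite upd4 ?E // => E2; case: rw1.
(* A color still available at [w0] would be a fourth one. *)
have := max_card (mem [:: a; b; g; k]).
have /card_uniqP -> : uniq [:: a; b; g; k].
  by rewrite /= !inE !negb_or (eq_sym a b) ba (eq_sym a g) ga (eq_sym a k) ka
    (eq_sym b g) gb (eq_sym b k) kb (eq_sym g k) kr.
by rewrite card_ord /= leqNgt ltnS t3.
Qed.

End BobStrategy.

(** * Paths that avoid the colored vertex *)

Section FreeTrunk.
Variables (T : finType) (e : rel T).
Hypotheses (sym : symmetric e) (irr : irreflexive e) (Hf : forest e).
Hypothesis no3 : forall v : T, #|[set u | e v u]| != 3.
Variable t : nat.
Hypothesis t3 : t <= 3.
Implicit Types (c : pcol T t).

(** Three neighbors suffice because degree three is excluded. *)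
Lemma big_of_nbrs v s : uniq s -> all (e v) s -> 2 < size s -> big e v.
Proof.
move=> us /allP es s3; rewrite /big ltn_neqAle eq_sym no3 (leq_trans s3) //.
rewrite -(card_uniqP us); apply: subset_leq_card; apply/subsetP => z /es.
by rewrite inE.
Qed.

(** The last edge of the path joins two big vertices and belongs to every suffix that has an
    edge. *)
Lemma has_big_edge_suffix w p q y p1 z p2 :
  w :: p = p1 ++ z :: p2 -> p2 <> [::] -> p = rcons q y ->
  big e (last w q) -> big e y -> has_big_edge e z p2.
Proof.
move=> E + Ep bq By; case/lastP: p2 E => // p2 y' E _.
move: E; rewrite Ep -rcons_cons -rcons_cons -rcons_cat => /rcons_inj[E <-].
apply: has_big_edge_last => //; suff -> : last z p2 = last w q by [].
by rewrite -[LHS](last_cat w p1 (z :: p2)) -E.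
Qed.

Lemma trunk_edge_sym a b : trunk_edge e a b = trunk_edge e b a.
Proof. by rewrite /trunk_edge sym orbC. Qed.

(** If [B] is adjacent to a vertex of the path, Bob drives Alice along the path from there.
    Otherwise the first small vertex among [w2] and [w3] is used for [split_win], and if both are
    big, [four_big_win] applies. *)
Lemma free_trunk_win c w0 w1 p q y B :
  path (trunk_edge e) w0 (w1 :: p) -> uniq [:: w0, w1 & p] -> 1 < size p ->
  big e w0 -> big e w1 ->
  w1 :: p = rcons q y -> big e (last w0 q) -> big e y ->
  c B <> None -> (forall v, c v <> None -> v = B) -> B \notin [:: w0, w1 & p] ->
  ~ alice_wins e false c.
Proof.
move=> Hp Hu sp b0 b1 Eq bq By cB Hc BN Hw.
have [/hasP[z Hz eBz]|/hasPn nadj] := boolP (has (e B) [:: w0, w1 & p]).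
  have brB v ps : branch e B z v -> c v <> None ->
      v = B /\ forall u, u \in z :: ps -> ~~ e v u.
    by move=> /(branch_neq irr Hf) vB /Hc.
  have [p1 [p2 E]] : exists p1 p2, [:: w0, w1 & p] = p1 ++ z :: p2.
    by case/path.splitPr: Hz => p1 p2; exists p1, p2.
  have sorted_w : path.sorted (trunk_edge e) (p1 ++ z :: p2) by rewrite -E.
  have tp2 : path (trunk_edge e) z p2.
    by case: (p1) sorted_w => [//|u p1'] /=; rewrite cat_path /= => /and3P[].
  have up : uniq (B :: p1 ++ z :: p2) by rewrite cons_uniq -E BN Hu.
  have uz : uniq [:: B, z & p2].
    move: up; rewrite cons_uniq mem_cat negb_or cat_uniq.
    by move=> /andP[/andP[_ BN2] /and3P[_ _ h]]; rewrite cons_uniq BN2.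
  (* If [z] is the end of the path, the last edge is played backwards; otherwise the play goes
     forwards from [z]. *)
  have [p20|p2N] := eqVneq p2 [::].
    subst p2; have zy : z = y.
      have : last w0 (w1 :: p) = last B (p1 ++ [:: z]) by rewrite -E.
      by rewrite Eq last_rcons last_cat.
    have [q' Eq'] : exists q', w0 :: q = rcons q' (last w0 q).
      by exists (belast w0 q); rewrite -lastI.
    have Ew : [:: w0, w1 & p] = q' ++ [:: last w0 q; y].
      by rewrite Eq -rcons_cons Eq' -cats1 -cats1 -catA.
    move: Hp Hu BN; rewrite -[path _ _ _]/(path.sorted (trunk_edge e) [:: w0, w1 & p]) Ew.
    rewrite zy in eBz brB *.
    have cat_sorted2 (s1 s2 : seq T) :
      path.sorted (trunk_edge e) (s1 ++ s2) -> path.sorted (trunk_edge e) s2.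
      by case: s1 => //= u s1; rewrite cat_path => /andP[_]; case: s2 => //= v s2 /andP[].
    move=> /cat_sorted2 /andP[t1 _].
    rewrite cat_uniq mem_cat => /and3P[_ _ /andP[n1 _]] /norP[_].
    rewrite !inE negb_or in n1 * => /andP[n2 n3].
    apply: (@trunk_win _ e sym irr Hf t t3 c B y [:: last w0 q] B cB eBz _ _ By _ _ Hw).
    - by rewrite /= trunk_edge_sym t1.
    - by rewrite /= !inE negb_or n2 n3 eq_sym n1.
    - by rewrite /= bq By.
    by move=> v Hv cv; apply: brB.
  apply: (@trunk_win _ e sym irr Hf t t3 c B z p2 B cB eBz tp2 uz _ _ _ Hw).
  (* [z] is big: it is [w0], or it has [B], its predecessor and its successor as neighbors. *)
  - case: p1 => [|u p1] in E sorted_w up *; first by case: E => <-.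
    case: p2 p2N => // v p2 _ in E sorted_w up tp2 uz *.
    move: sorted_w; rewrite /= cat_path => /and3P[_ /andP[lz _] /andP[/andP[zv _] _]].
    apply: (@big_of_nbrs z [:: B; last u p1; v]) => //.
      rewrite -cat1s catA in up; move: up; rewrite cat_uniq => /and3P[h1 h2 h3].
      have lm : last u p1 \in B :: u :: p1 by rewrite in_cons mem_last orbT.
      move: h2 => /hasPn h2.
      have vn' : v \notin [:: B, u & p1] by apply: h2; rewrite !in_cons eqxx orbT.
      move: h1; rewrite /= => /andP[h1 _].
      rewrite /= !inE negb_or andbT -andbA; apply/and3P; split.
      + by apply: contraNneq h1 => ->; rewrite mem_last.
      + by apply: contraNneq vn' => ->; rewrite mem_head.
      + by apply: contraNneq vn' => <-; rewrite lm.
    by rewrite /= (sym z) eBz (sym z) lz zv.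
  - exact: (has_big_edge_suffix E (elimN eqP p2N) Eq).
  by move=> v Hv cv; apply: brB.
have Hz z : z \in [:: w0, w1 & p] -> c z = None /\ ~~ e B z.
  move=> zp; split; last exact: nadj.
  by case E: (c z) => [k|//]; move: BN; rewrite -(Hc z) ?zp ?E.
have [a cBa] : exists a, c B = Some a by case: (c B) cB => // a; exists a.
case: p => [|w2 [|w3 p]] // in Hp Hu sp Eq BN nadj Hz *.
have /and4P[t01 t12 t23 tp] := Hp.
have sfx p1 z p2 : [:: w0, w1, w2, w3 & p] = p1 ++ z :: p2 -> p2 <> [::] ->
  has_big_edge e z p2 by move=> E E2; apply: (has_big_edge_suffix E E2 Eq).
have [b2|b2] := boolP (big e w2); last first.
  have b3 : big e w3 by move: t23 => /andP[_]; rewrite (negbTE b2).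
  apply: (@split_win _ e sym irr Hf t t3 c w0 w1 w2 w3 p B a) Hw => //.
  (* The path cannot end at [w3], since both ends of its last edge are big and [w2] is small. *)
  case: p => [|w4 p] in Hp Hu sp Eq BN nadj Hz tp sfx *.
    have := sfx [:: w0; w1] w2 [:: w3] erefl; rewrite /= (negbTE b2) /=.
    by move=> H; suff: false by []; apply: H.
  exact: (sfx [:: w0; w1; w2]).
have [b3|b3] := boolP (big e w3); last first.
  case: p => [|w4 p] in Hp Hu sp Eq BN nadj Hz tp sfx *.
    have := sfx [:: w0; w1] w2 [:: w3] erefl; rewrite /= (negbTE b3) andbF /=.
    by move=> H; suff: false by []; apply: H.
  have /andP[t34 tp4] := tp.
  have b4 : big e w4 by move: t34 => /andP[_]; rewrite (negbTE b3).
  apply: (@split_win _ e sym irr Hf t t3 c w1 w2 w3 w4 p B a) Hw => //.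
  - by case/andP: Hp.
  - by case/andP: Hu.
  - case: p => [|w5 p] in Hp Hu sp Eq BN nadj Hz tp sfx tp4 *; last first.
      exact: (sfx [:: w0; w1; w2; w3]).
    have := sfx [:: w0; w1; w2] w3 [:: w4] erefl; rewrite /= (negbTE b3) /=.
    by move=> H; suff: false by []; apply: H.
  by move=> z zp; apply: Hz; rewrite in_cons zp orbT.
have e01 : e w0 w1 by case/andP: t01.
have e12 : e w1 w2 by case/andP: t12.
have e23 : e w2 w3 by case/andP: t23.
have u4 : uniq [:: w0; w1; w2; w3].
  by move: Hu; rewrite -[_ :: _]/([:: w0; w1; w2; w3] ++ p) cat_uniq => /andP[].
have Hz4 z : z \in [:: w0; w1; w2; w3] -> c z = None /\ ~~ e B z.
  move=> zp; apply: Hz; rewrite -[_ :: _]/([:: w0; w1; w2; w3] ++ p).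
  by rewrite mem_cat zp.
(* [B] is not on both sides of the edge between [w1] and [w2], so one of the two orientations of the
   path meets the requirement of [four_big_win]. *)
apply: (@em_False (branch e w2 w1 B)) => -[HB|HB].
  apply: (@four_big_win _ e sym irr Hf t t3 c w3 w2 w1 w0 B a) Hw => //.
  - by rewrite /= (sym w3) e23 (sym w2) e12 (sym w1) e01.
  - by have := rev_uniq [:: w0; w1; w2; w3]; rewrite u4.
  - by rewrite /= b0 b1 b2 b3.
  - move=> z zp; apply: Hz4; have := mem_rev [:: w0; w1; w2; w3] z.
    by rewrite zp.
  by move=> /branch_opp; apply.
apply: (@four_big_win _ e sym irr Hf t t3 c w0 w1 w2 w3 B a) Hw => //.
- by rewrite /= e01 e12 e23.
- by rewrite /= b0 b1 b2 b3.
Qed.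

End FreeTrunk.

(** * Reading the trunks of the reduced graph *)

(** Take a simple path to [x]. If it avoids [y], append [y]; otherwise cut it at [y] and step to
    [x]. *)
Lemma uniq_path_to_edge (T : finType) (r : rel T) z x y :
  symmetric r -> connect r z x -> r x y -> x != y ->
  exists q y', [/\ path r z (rcons q y'), uniq (z :: rcons q y') &
    (last z q, y') \in [:: (x, y); (y, x)]].
Proof.
move=> sr /connectP[p0 hp0 Ex] rxy nxy.
case/path.shortenP: hp0 Ex => p hp up _ Ex.
have [Hy|Hy] := boolP (y \in z :: p); last first.
  exists p, y; rewrite -Ex mem_head rcons_path hp -Ex rxy; split=> //.
  by rewrite -rcons_cons rcons_uniq Hy up.
move: Hy; rewrite in_cons => /orP[/eqP E|Hy].
  exists [::], x; rewrite /= -E sr rxy !inE eqxx orbT; split=> //.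
  by rewrite eq_sym nxy.
case/path.splitPr: Hy => p1 p2 in hp up Ex *.
exists (rcons p1 y), x; rewrite last_rcons !inE eqxx orbT; split=> //.
  move: hp; rewrite cat_path /= => /and3P[h1 h2 _].
  by rewrite !rcons_path h1 h2 last_rcons sr rxy.
move: Ex; rewrite last_cat /= => Ex.
have xp : x \in p2.
  by move: (mem_last y p2); rewrite -Ex in_cons (negbTE nxy).
move: up; rewrite -cat_rcons -cat_cons cat_uniq => /and3P[h1 /hasPn h2 _].
rewrite -cons_uniq -rcons_cons rcons_uniq h1 andbT; exact: h2.
Qed.

Section TrunkPaths.
Variables (T : finType) (e : rel T).
Hypotheses (sym : symmetric e) (irr : irreflexive e) (Hf : forest e).
Hypothesis no3 : forall v : T, #|[set u | e v u]| != 3.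
Variables (b : T) (K : Type) (alpha : K).

Let V := [set: T].
Let E := edges_of e.
Let c0 := color_one b alpha.
Let V' := R'_V V E c0.
Let E' := R'_E V E c0.
Let c' := R'_col c0 : Rtype T -> option K.

Variables (S : {set Rtype T}) (D : {set Rtype T * Rtype T}).
Hypothesis HS : is_trunk V' E' c' S D.

Let sub : [/\ S \subset V', D \subset E' &
  forall p, p \in D -> [/\ p.1 \in S, p.2 \in S & (p.2, p.1) \in D]].
Proof.
case/andP: HS => /and3P[/and3P[h1 h2 /forall_inP h3] _ _] _.
by split=> // p /h3 /and3P.
Qed.

Let conn X Y : X \in S -> Y \in S -> connect (fun a c => (a, c) \in D) X Y.
Proof.
case/andP: HS => /and3P[_ /andP[_ /forall_inP h] _] _ XS YS.
by move/forall_inP: (h X XS); apply.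
Qed.

Let Dsym : symmetric (fun X Y => (X, Y) \in D).
Proof. by case: sub => _ _ h X Y; apply/idP/idP => /h[]. Qed.

Let D_R X Y : (X, Y) \in D ->
  [/\ X.1 = Y.1, is_trunk V E c0 X.1.1 X.1.2 & (X.2, Y.2) \in X.1.2].
Proof.
case: sub => _ /subsetP h _ /h; rewrite !inE /= => /andP[/and3P[/eqP -> h1 h2] _].
by rewrite h1.
Qed.

Let D_edge X Y : (X, Y) \in D -> e X.2 Y.2.
Proof.
case/D_R => _ /andP[/and3P[/and3P[_ /subsetP h _] _ _] _] /h.
by rewrite inE.
Qed.

Let R_deg X : deg (R_V V E c0) (R_E V E c0) X <= deg X.1.1 X.1.2 X.2.
Proof.
rewrite /deg -(@card_in_imset _ _ snd) => [|Y Z].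
  apply: subset_leq_card; apply/subsetP => _ /imsetP[Y + ->].
  rewrite !inE => /andP[/andP[_ h] /and3P[/eqP h1 _ h2]].
  by rewrite h1 h -h1.
rewrite !inE => /andP[_ /and3P[/eqP h1 _ _]] /andP[_ /and3P[/eqP h2 _ _]].
by case: Y Z h1 h2 => [Y y] [Z z] /= <- <- ->.
Qed.

Let deg_sub (U U' : {set Rtype T}) (F F' : {set Rtype T * Rtype T}) X :
  U \subset U' -> F \subset F' -> deg U F X <= deg U' F' X.
Proof.
move=> /subsetP h1 /subsetP h2; apply: subset_leq_card; apply/subsetP => Y.
by rewrite !inE => /andP[/h1 -> /h2 ->].
Qed.

Let E'R : E' \subset R_E V E c0. Proof. exact: subsetIl. Qed.

(** A colored vertex is a leaf of its trunk, so degree above two rules out [b]; with degree three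
    excluded, it also makes the vertex big in the forest. *)
Let big_of_deg X : X \in S -> 2 < deg (R_V V E c0) (R_E V E c0) X ->
  big e X.2 /\ X.2 <> b.
Proof.
case: sub => /subsetP h _ _ /h; rewrite inE => /andP[tr xR] /leq_trans/(_ (R_deg X)) d.
case/andP: tr => /and3P[/and3P[_ /subsetP hE _] _ /forall_inP hc] _.
split.
  rewrite /big ltn_neqAle eq_sym no3; apply: leq_trans d _.
  apply: subset_leq_card; apply/subsetP => y; rewrite !inE => /andP[_ /hE].
  by rewrite inE.
move=> Xb; move/implyP: (hc _ xR); rewrite /c0 /color_one Xb eqxx /= => /(_ isT).
by rewrite -Xb => /eqP d1; rewrite d1 in d.
Qed.

Let big_S X : X \in S -> 2 < deg S D X -> big e X.2 /\ X.2 <> b.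
Proof.
case: sub => h1 h2 _ XS d; apply: big_of_deg => //; apply: leq_trans d _.
by apply: deg_sub => //; apply: subset_trans E'R.
Qed.

Let big_E' X : X \in S -> 2 < deg V' E' X -> big e X.2 /\ X.2 <> b.
Proof.
by move=> XS d; apply: big_of_deg => //; apply: leq_trans d _; apply: deg_sub.
Qed.

Let D_big X Y : (X, Y) \in D -> (big e X.2 /\ X.2 <> b) \/ (big e Y.2 /\ Y.2 <> b).
Proof.
move=> XY; case: sub => _ /subsetP hE /(_ _ XY) /= [XS YS _].
by move: (hE _ XY); rewrite !inE => /andP[_ /andP[_ /orP[]]] /= d;
  [left|right]; apply: big_of_deg.
Qed.

Let D_trunk X Y : (X, Y) \in D -> trunk_edge e X.2 Y.2.
Proof.
by move=> XY; rewrite /trunk_edge D_edge //; case: (D_big XY) => -[-> _]; rewrite ?orbT.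
Qed.

Let D_path X p : path (fun Y Z => (Y, Z) \in D) X p ->
  path (trunk_edge e) X.2 [seq Y.2 | Y <- p] /\ all (fun Y => Y.1 == X.1) p.
Proof.
elim: p X => //= Y p IH X /andP[XY /IH[h1 h2]].
have [E1 _ _] := D_R XY; rewrite D_trunk //= h1 E1 eqxx. by split; rewrite ?E1.
Qed.

(** The trunk component is constant along a path, so distinct vertices of the path project to
    distinct vertices of the forest. *)
Let D_uniq X p : path (fun Y Z => (Y, Z) \in D) X p -> uniq (X :: p) ->
  uniq (X.2 :: [seq Y.2 | Y <- p]).
Proof.
move=> /D_path[_ /allP h] up; rewrite -[_ :: _]/(map snd (X :: p)) map_inj_in_uniq //.
have h' Y : Y \in X :: p -> Y.1 = X.1.
  by rewrite in_cons => /orP[/eqP->|/h/eqP].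
by move=> [Y y] [Z z] /h' /= -> /h' /= -> /= ->.
Qed.

Let D_in_S X p : X \in S -> path (fun Y Z => (Y, Z) \in D) X p -> all [in S] (X :: p).
Proof.
move=> XS; rewrite /= XS /=; elim: p X {XS} => //= Y p IH X /andP[XY /IH ->].
by case: sub => _ _ /(_ _ XY)[_ -> _].
Qed.

Variables (t : nat).
Hypothesis t3 : t <= 3.
Implicit Types (c : pcol T t).

Lemma colored_trunk_win c : c b <> None -> (forall v, c v <> None -> v = b) ->
  n_colored c' S = 1 -> (exists p, p \in D /\ p \in E_ggt2 V' E') ->
  ~ alice_wins e false c.
Proof.
move=> cb Hc /eqP/cards1P[X0 EX0] [[X Y] [XY]].
rewrite inE /= => /and3P[_ dX dY] Hw.
have : X0 \in [set X0] by rewrite inE.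
rewrite -EX0 inE /c' /R'_col /R_col /c0 /color_one => /andP[X0S].
case: eqP => // X0b _.
have [_ _ /(_ _ XY)[/= XS YS _]] := sub.
have [bX Xb] := big_E' XS dX; have [bY Yb] := big_E' YS dY.
have nXY : X != Y by apply: contraTneq (D_edge XY) => ->; rewrite irr.
have [q [y' [hq uq hl]]] := uniq_path_to_edge Dsym (conn X0S XS) XY nXY.
have [b1 [n1 b2]] : big e (last X0 q).2 /\ (last X0 q).2 <> b /\ big e y'.2.
  by move: hl; rewrite !inE => /orP[] /eqP[-> ->].
(* The ends of the target edge differ from [b], so the path from the copy of [b] has a vertex [Z1]
   before its last one; [Z1] is big because [b] is not a big end of its edge. *)
case: q => [|Z1 q] in hq uq b1 n1 {hl} *; first by case: n1.
have := D_uniq hq uq; have [] := D_path hq.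
rewrite /= map_rcons X0b => /andP[_ hp] _ ub.
have XZ : (X0, Z1) \in D by case/andP: hq.
apply: (@trunk_win _ e sym irr Hf t t3 c b Z1.2 (rcons (map snd q) y'.2) b cb _ hp ub _ _ _ Hw).
- by rewrite -X0b D_edge.
- by case: (D_big XZ) => -[h1 h2] //; case: h2.
- by apply: has_big_edge_last => //; rewrite last_map.
by move=> v /(branch_neq irr Hf) vb /Hc.
Qed.

Lemma uncolored_trunk_win c : c b <> None -> (forall v, c v <> None -> v = b) ->
  n_colored c' S = 0 -> (forall X, X \in S -> ~~ covers X (E_ggt2 S D)) ->
  ~ alice_wins e false c.
Proof.
move=> cb Hc /eqP; rewrite cards_eq0 => /eqP n0 ncov Hw.
have nb X : X \in S -> X.2 <> b.
  move=> XS Xb; have := in_set0 X; rewrite -n0 inE XS /c' /R'_col /R_col /c0.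
  by rewrite /color_one Xb eqxx.
have [X0 X0S] : exists X, X \in S.
  by case/andP: HS => /and3P[_ /andP[/set0Pn h _] _] _.
have mem_D X Y : (X, Y) \in E_ggt2 S D ->
    [/\ (X, Y) \in D, X \in S, Y \in S, big e X.2 & big e Y.2].
  rewrite inE => /and3P[XY dX dY]; have [_ _ /(_ _ XY)[/= XS YS _]] := sub.
  by split=> //; [case: (big_S XS dX)|case: (big_S YS dY)].
have avoid X : X \in S -> exists A B, [/\ (A, B) \in E_ggt2 S D, A != X & B != X].
  move=> /ncov /forall_inPn[[A B] h]; rewrite negb_or => /andP[h1 h2].
  by exists A, B.
have gsym A B : (A, B) \in E_ggt2 S D -> (B, A) \in E_ggt2 S D.
  rewrite !inE /= => /and3P[h1 h2 h3]; rewrite h2 h3 !andbT.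
  by have [_ _ /(_ _ h1)[]] := sub.
(* Two disjoint edges: given an edge from [X] to [Y], take one edge that avoids [X] and one that
   avoids [Y]. If neither is disjoint from the given edge, they are disjoint from each other, since
   the forest has no triangle. *)
have [X1 [Y1 [X2 [Y2 [h1 h2 [n1 n2 n3 n4]]]]]] : exists X1 Y1 X2 Y2,
    [/\ (X1, Y1) \in E_ggt2 S D, (X2, Y2) \in E_ggt2 S D &
        [/\ X1 != X2, X1 != Y2, Y1 != X2 & Y1 != Y2]].
  have [X [Y [XY _ _]]] := avoid X0 X0S.
  have [_ XS YS _ _] := mem_D _ _ XY.
  have gen Z : Z \in S -> forall Z', (exists W, (Z', W) \in E_ggt2 S D /\ W != Z /\ Z' != Z) \/
     (exists A B, [/\ (A, B) \in E_ggt2 S D & [/\ A != Z, B != Z, A != Z' & B != Z']]).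
    move=> ZS Z'; have [A [B [AB AZ BZ]]] := avoid Z ZS.
    have [E1|nA] := eqVneq A Z'; first by left; exists B; rewrite -E1.
    have [E1|nB] := eqVneq B Z'; first by left; exists A; rewrite -E1 gsym.
    by right; exists A, B.
  case: (gen X XS Y) => [[W [YW [WX _]]]|[A [B [AB [? ? ? ?]]]]]; last first.
    by exists X, Y, A, B; rewrite ![X == _]eq_sym ![Y == _]eq_sym.
  case: (gen Y YS X) => [[Z [XZ [ZY _]]]|[A [B [AB [? ? ? ?]]]]]; last first.
    by exists X, Y, A, B; rewrite ![X == _]eq_sym ![Y == _]eq_sym.
  exists X, Z, Y, W; split=> //.
  have [D1 _ _ _ _] := mem_D _ _ XY; have [D2 _ _ _ _] := mem_D _ _ YW.
  have [D3 _ _ _ _] := mem_D _ _ XZ.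
  have nXY : X != Y by apply: contraTneq (D_edge D1) => ->; rewrite irr.
  rewrite nXY ZY [X == _]eq_sym WX; split=> //.
  apply: contraTneq (D_edge D3) => ->; rewrite sym.
  apply: no_triangle (D_edge D1) (D_edge D2) _ => // E2.
  have [E3 _ _] := D_R D1; have [E4 _ _] := D_R D2.
  case/eqP: WX; case: (X) (Y) (W) E2 E3 E4 => [? ?] [? ?] [? ?] /= -> -> ->.
  by [].
have [D1 X1S Y1S bX1 bY1] := mem_D _ _ h1.
have [D2 X2S Y2S bX2 bY2] := mem_D _ _ h2.
have nXY1 : X1 != Y1 by apply: contraTneq (D_edge D1) => ->; rewrite irr.
have nXY2 : X2 != Y2 by apply: contraTneq (D_edge D2) => ->; rewrite irr.
have [q [y' [hq uq hl]]] := uniq_path_to_edge Dsym (conn X1S X2S) D2 nXY2.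
have [l1 l2 [l3 l4] [l5 l6]] : [/\ big e (last X1 q).2, big e y'.2,
    last X1 q != X1 /\ last X1 q != Y1 & y' != X1 /\ y' != Y1].
  by move: hl; rewrite !inE => /orP[] /eqP[-> ->]; rewrite !(eq_sym X2, eq_sym Y2).
have main w0 w1 q' : path (fun Y Z => (Y, Z) \in D) w0 (w1 :: rcons q' y') ->
    uniq [:: w0, w1 & rcons q' y'] -> w0 \in S -> big e w0.2 -> big e w1.2 ->
    last w1 q' = last X1 q -> q' <> [::] -> False.
  move=> hp up w0S b0 b1 El qN.
  have [hp' _] := D_path hp; have up' := D_uniq hp up.
  have /allP inS := D_in_S w0S hp.
  apply: (@free_trunk_win _ e sym irr Hf no3 t t3 c w0.2 w1.2 (map snd (rcons q' y'))
    (w1.2 :: map snd q') y'.2 b hp' up' _ b0 b1 _ _ l2 cb Hc _ Hw).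
  - by rewrite size_map size_rcons; case: (q') qN.
  - by rewrite map_rcons.
  - by rewrite /= last_map El.
  rewrite -[_ :: _]/(map snd [:: w0, w1 & rcons q' y']).
  by apply/negP => /mapP[Z /inS /nb Zb /esym].
(* If the path from [X1] passes through [Y1], the detour is replaced by the edge from [X1] to [Y1];
   otherwise [Y1] is put in front. *)
have [Hy|Hy] := boolP (Y1 \in q).
  case/path.splitPr: Hy => p1 p2 in hq uq l1 l3 l4 main {hl} *.
  move: hq; rewrite rcons_cat cat_path /= => /and3P[_ _ hp].
  apply: (main X1 Y1 p2) => //.
  - by rewrite /= D1.
  - move: uq; rewrite rcons_cat cons_uniq mem_cat negb_or cat_uniq.
    by move=> /andP[/andP[_ u1] /and3P[_ _ u2]]; rewrite cons_uniq u1.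
  - by rewrite last_cat.
  by move=> E1; move: l4; rewrite last_cat E1 /= eqxx.
apply: (main Y1 X1 q) => //.
- by rewrite /= Dsym D1.
- rewrite cons_uniq uq andbT in_cons negb_or eq_sym nXY1 /= mem_rcons in_cons.
  by rewrite negb_or eq_sym l6.
by move=> E1; move: l3; rewrite E1 /= eqxx.
Qed.

End TrunkPaths.

Lemma lower_bound (T : finType) (e : rel T) t :
  symmetric e -> irreflexive e -> forest e -> 0 < #|T| ->
  (forall v : T, #|[set u | e v u]| != 3) ->
  (forall (b : T) (alpha : 'I_3), trunk_hyp e b alpha) ->
  alice_wins_game e t -> 3 < t.
Proof.
move=> sym irr Hf /card_gt0P[x _] no3 hyp Hw; rewrite ltnNge; apply/negP => t3.
have [|b [a [_ H]]] := @alice_move _ _ _ _ x Hw; first by rewrite ffunE.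
have cb : upd [ffun=> None] b a b <> None by rewrite updE eqxx.
have Hc v : upd [ffun=> None] b a v <> None -> v = b.
  by rewrite updE ffunE; case: eqP.
(* Trunks depend only on which vertex is colored, so [ord0] may stand for the color that Alice
   chose. *)
have [S [D [HS [[h1 h2]|[h1 h2]]]]] := hyp b ord0.
  exact: (colored_trunk_win sym irr Hf no3 HS t3 cb Hc h1 h2 H).
exact: (uncolored_trunk_win sym irr Hf no3 HS t3 cb Hc h1 h2 H).
Qed.

(** * Alice's strategy with four colors *)

Section Elimination.
Variables (T : finType) (e : rel T).
Hypotheses (sym : symmetric e) (irr : irreflexive e) (Hf : forest e).

(** If every vertex of [S] had two neighbors in [S], a nonbacktracking walk could be prolonged until
    it had more than [#|T|] distinct vertices. *)
Lemma forest_leaf (S : {set T}) x0 : x0 \in S ->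
  exists2 x, x \in S & {in S &, forall y z, e x y -> e x z -> y = z}.
Proof.
move=> x0S; pose leaf x := [forall y in S, forall z in S, e x y ==> e x z ==> (y == z)].
case: (pickP (fun x => (x \in S) && leaf x)) => [x /andP[xS Hx]|noleaf].
  exists x => // y z yS zS xy xz; move/forall_inP/(_ y yS)/forall_inP/(_ z zS): Hx.
  by rewrite xy xz => /eqP.
have two x : x \in S -> exists y z, [/\ y \in S, z \in S, e x y, e x z & y != z].
  move=> xS; have := noleaf x; rewrite xS /= => /negbT /forall_inPn[y yS].
  move=> /forall_inPn[z zS]; rewrite !negb_imply => /and3P[xy xz yz].
  by exists y, z.
have long n : exists x y p, [/\ x \in S, nbwalk e [:: x, y & p] & size p = n].
  elim: n => [|n [x [y [p [xS H sp]]]]].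
    have [y [_ [_ _ xy _ _]]] := two x0 x0S; exists x0, y, [::].
    by rewrite /= xy.
  have [z [zS xz zy]] : exists z, [/\ z \in S, e x z & z != y].
    have [z1 [z2 [z1S z2S xz1 xz2 z12]]] := two x xS.
    have [E|] := eqVneq z1 y; last by exists z1.
    by exists z2; rewrite -E eq_sym.
  exists z, x, (y :: p); rewrite /= sp; split=> //.
  by move: H => /= /and3P[-> -> ->]; rewrite sym xz zy.
have [x [y [p [_ /(nbwalk_uniq irr Hf)/card_uniqP H sp]]]] := long #|T|.
by have := max_card (mem [:: x, y & p]); rewrite H /= sp ltnNge leqnSn.
Qed.

Lemma elimination_order : exists r : T -> nat, injective r /\
  forall x y z, e x y -> e x z -> r x < r y -> r x < r z -> y = z.
Proof.
suff [r [r1 r2]] : exists r : T -> nat, {in [set: T] &, injective r} /\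
    {in [set: T] & &, forall x y z, e x y -> e x z -> r x < r y -> r x < r z -> y = z}.
  by exists r; split=> [x y|x y z]; [apply: r1|apply: r2]; rewrite inE.
have [n] := ubnP #|[set: T]|; elim: n [set: T] => // n IH S Sn.
have [->|[x xS]] := set_0Vmem S.
  by exists (fun=> 0); split=> [x y|x y z]; rewrite inE.
have [{xS} x xS Hx] := forest_leaf xS.
have [|r [r1 r2]] := IH (S :\ x); first by rewrite (cardsD1 x) xS in Sn.
have inS y : y \in S -> y == x = false -> y \in S :\ x by rewrite !inE => -> ->.
(* The removed leaf comes first, and the ranks of the others are shifted. *)
exists (fun y => if y == x then 0 else (r y).+1); split=> [y z yS zS|y z w yS zS wS].
  case: eqP => [->|/eqP/negbTE yx]; case: eqP => [->|/eqP/negbTE zx] // [].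
  by apply: r1; apply: inS.
case: eqP => [->|/eqP/negbTE yx]; first by move=> ? ? _ _; apply: Hx.
case: eqP => [//|/eqP/negbTE zx]; case: eqP => [//|/eqP/negbTE wx] h1 h2.
by rewrite !ltnS; apply: r2 h1 h2; apply: inS.
Qed.

End Elimination.

Section AliceStrategy.
Variables (T : finType) (e : rel T) (r : T -> nat).
Hypotheses (sym : symmetric e) (irr : irreflexive e) (rI : injective r).
Hypothesis up1 : forall x y z, e x y -> e x z -> r x < r y -> r x < r z -> y = z.
Implicit Types (c : pcol T 4).

Definition up x y := e x y && (r x < r y).

Lemma up_fun x y z : up x y -> up x z -> y = z.
Proof. by move=> /andP[? ?] /andP[? ?]; apply: (@up1 x). Qed.

Lemma connect_up_leq x y : connect up x y -> r x <= r y.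
Proof.
move=> /connectP[p hp ->]; elim: p x hp => //= z p IH x /andP[/andP[_ xz] /IH].
exact/leq_trans/ltnW.
Qed.

Lemma connect_up_step x y : connect up x y -> x != y ->
  forall z, up x z -> connect up z y.
Proof.
move=> /connectP[[|w p] /= hp ->]; first by rewrite eqxx.
move: hp => /andP[xw hp] _ z /(up_fun xw) <-.
by apply/connectP; exists p.
Qed.

Lemma connect_up_total x y z : connect up x y -> connect up x z ->
  connect up y z || connect up z y.
Proof.
move=> /connectP[p hp ->] {y}; elim: p x hp => [|w p IH] x /= => [_ ->//|/andP[xw hp] xz].
have [<-|nxz] := eqVneq x z; last by apply: IH hp _; apply: connect_up_step xz nxz _ xw.
apply/orP; right; apply/connectP; exists (w :: p) => //.
by rewrite /= xw.
Qed.

Definition active c := [set u | [exists v, (c v != None) && connect up v u]].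
Definition active_below c u := [set w in active c | up w u].

Lemma colored_active c v : c v <> None -> v \in active c.
Proof. by move=> /eqP cv; rewrite inE; apply/existsP; exists v; rewrite cv /=. Qed.

Lemma active_up c u w : u \in active c -> connect up u w -> w \in active c.
Proof.
rewrite !inE => /existsP[v /andP[cv vu]] uw; apply/existsP; exists v.
by rewrite cv (connect_trans vu uw).
Qed.

Lemma active_upd c v a u : c v = None ->
  (u \in active (upd c v a)) = (u \in active c) || connect up v u.
Proof.
move=> cv; rewrite !inE; apply/existsP/orP => [[w]|[/existsP[w /andP[cw wu]]|vu]].
- rewrite updE; case: (w =P v) => [-> /andP[_ h]|_ h]; first by right.
  by left; apply/existsP; exists w.
- by exists w; rewrite updE wu andbT; case: (w =P v).
by exists v; rewrite updE eqxx vu.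
Qed.

(* Alice restores this before each of Bob's moves. *)
Definition tame c := forall u, c u = None -> #|active_below c u| <= 1.

(** Colored neighbors are active children or the parent: at most two and one, so that a fourth color
    remains. *)
Lemma colored_nbrs c u : #|active_below c u| <= 2 ->
  #|[set z | e u z && (c z != None)]| <= 3.
Proof.
move=> H; apply: (@leq_trans #|active_below c u :|: [set z | up u z]|).
  apply: subset_leq_card; apply/subsetP => z; rewrite in_setU 3!inE => /andP[uz cz].
  rewrite (colored_active (elimN eqP cz)) /up sym uz /=.
  case: ltngtP => // /rI E; by rewrite E irr in uz.
apply: (leq_trans (leq_card_setU _ _)); apply: (@leq_trans (2 + 1)) => //.
apply: leq_add => //; apply/card_le1_eqP => y z; rewrite !inE; by move=> h1 h2; apply: up_fun h2 h1.
Qed.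

Lemma exists_color c u : #|active_below c u| <= 2 -> exists a, available e c u a.
Proof.
move=> /colored_nbrs H; pose used := [set odflt ord0 (c z) | z in [set z | e u z && (c z != None)]].
have [a] : exists a : 'I_4, a \notin used.
  apply/existsP; rewrite -negb_forall; apply/negP => /forallP all_used.
  have : #|'I_4| <= #|used| by apply: subset_leq_card; apply/subsetP => a _.
  by rewrite card_ord leqNgt ltnS (leq_trans (leq_imset_card _ _)).
move=> /imsetP na; exists a => z zu cz; apply: na; exists z; last by rewrite cz.
by rewrite inE sym zu cz.
Qed.

Lemma not_blocked c : (forall u, c u = None -> #|active_below c u| <= 2) -> ~ blocked e c.
Proof. by move=> H [u [cu Hu]]; have [a /Hu] := exists_color (H u cu). Qed.

Lemma active_below_upd c v a u : c v = None ->
  active_below (upd c v a) u = active_below c u :|: [set w | connect up v w && up w u].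
Proof. by move=> cv; apply/setP => w; rewrite !(inE, active_upd) //= andb_orl. Qed.

(** The chain of parents of [v] is linear and enters [u] through one child only; thus a move adds at
    most one active child anywhere. *)
Lemma chain_below v u : #|[set w | connect up v w && up w u]| <= 1.
Proof.
have key w1 w2 : up w1 u -> up w2 u -> connect up w1 w2 -> w1 = w2.
  move=> h1 h2 h; have [//|n] := eqVneq w1 w2.
  have /connect_up_leq := connect_up_step h n h1.
  by case/andP: h2 => _; rewrite ltnNge => /negP.
apply/card_le1_eqP => w1 w2; rewrite !inE => /andP[v1 h1] /andP[v2 h2].
by case/orP: (connect_up_total v1 v2) => h; [exact/esym/(key _ _ h1 h2)|exact: (key _ _ h2 h1)].
Qed.

Lemma below_active c w u : w \in active c -> up w u -> u \in active c.
Proof. by move=> wA wu; apply: active_up wA (connect1 wu). Qed.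

(** An overloaded vertex was active before the move and gains an inactive child on the chain of [v]:
    it is the place where that chain first meets the active vertices. *)
Lemma overloaded_unique c v a u1 u2 : tame c -> c v = None ->
  c u1 = None -> c u2 = None ->
  1 < #|active_below (upd c v a) u1| -> 1 < #|active_below (upd c v a) u2| -> u1 = u2.
Proof.
move=> tc cv.
have key u : c u = None -> 1 < #|active_below (upd c v a) u| ->
    u \in active c /\ exists w, [/\ connect up v w, up w u & w \notin active c].
  move=> cu; rewrite active_below_upd // => H; split.
    have [E|[w]] := set_0Vmem (active_below c u).
      by move: H; rewrite E set0U ltnNge chain_below.
    by rewrite inE => /andP[wA]; apply: below_active.
  have [/existsP[w /and3P[? ? ?]]|] :=
      boolP [exists w, [&& connect up v w, up w u & w \notin active c]]; first by exists w.
  rewrite negb_exists => /forallP nw; move: H; rewrite ltnNge => /negP[].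
  apply: leq_trans (tc u cu); apply: subset_leq_card; apply/subsetP => w.
  rewrite in_setU => /orP[//|]; rewrite !inE => /andP[h1 h2].
  by have := nw w; rewrite h1 h2 andbT /= negbK inE.
move=> c1 c2 /(key _ c1)[A1 [w1 [v1 h1 n1]]] /(key _ c2)[A2 [w2 [v2 h2 n2]]].
have [E|n12] := eqVneq w1 w2; first by rewrite -E in h2; apply: up_fun h1 h2.
case/orP: (connect_up_total v1 v2) => h.
  by case/negP: n2; apply: active_up A1 (connect_up_step h n12 h1).
case/negP: n1; apply: active_up A2 _; apply: connect_up_step h _ _ h2.
by rewrite eq_sym.
Qed.

(** Alice colors the overloaded vertex if there is one; it is active, so nothing new becomes active.
    Otherwise she colors the uncolored vertex of highest rank: its parent, if any, is colored, so
    its chain above is active already. *)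
Lemma tame_reply c v a : tame c -> c v = None -> ~ all_colored (upd c v a) ->
  exists u b, legal e (upd c v a) u b /\ tame (upd (upd c v a) u b).
Proof.
move=> tc cv nall; set c1 := upd c v a in nall *.
have c1N u : c1 u = None -> c u = None by rewrite /c1 updE; case: eqP.
have le2 u : c1 u = None -> #|active_below c1 u| <= 2.
  move=> cu; rewrite active_below_upd //; apply: leq_trans (leq_card_setU _ _) _.
  by apply: (@leq_trans (1 + 1)) => //; apply: leq_add; [apply: tc; apply: c1N|apply: chain_below].
have [u /andP[/eqP cu Hu]|noover] :=
    pickP (fun u => (c1 u == None) && (1 < #|active_below c1 u|)).
  have [b Hb] := exists_color (le2 u cu); exists u, b; split=> // u' cu'.
  have [u'u cu1] : u' <> u /\ c1 u' = None by move: cu'; rewrite updE; case: eqP.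
  rewrite active_below_upd // leqNgt; apply/negP.
  have uA : u \in active c1.
    have [w] : exists w, w \in active_below c1 u.
      by apply/set0Pn; rewrite -card_gt0; apply: leq_trans Hu.
    by rewrite inE => /andP[wA]; apply: below_active.
  have -> : active_below c1 u' :|: [set w | connect up u w && up w u'] = active_below c1 u'.
    apply/setUidPl/subsetP => w; rewrite !inE => /andP[h1 ->].
    by move: (active_up uA h1); rewrite inE => ->.
  move=> Hu'; case: u'u.
  exact: (overloaded_unique tc cv (c1N _ cu1) (c1N _ cu) Hu' Hu).
have le1 u : c1 u = None -> #|active_below c1 u| <= 1.
  by move=> cu; have := noover u; rewrite cu /= => /negbT; rewrite -leqNgt.
have [u0 cu0] : exists u, c1 u == None.
  case: (pickP (fun u => c1 u == None)) => [u h|H]; first by exists u.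
  by case: nall => u cu; have := H u; rewrite cu.
case: (@arg_maxnP _ u0 (fun u => c1 u == None) r cu0) => u /eqP cu max_u.
have [b Hb] := exists_color (le2 u cu); exists u, b; split=> // u' cu'.
have [u'u cu1] : u' <> u /\ c1 u' = None by move: cu'; rewrite updE; case: eqP.
rewrite active_below_upd //; apply: leq_trans (le1 u' cu1).
apply: subset_leq_card; apply/subsetP => w; rewrite in_setU => /orP[//|].
rewrite inE => /andP[uw wu']; have [E|nuw] := eqVneq u w.
  rewrite -E in wu'; have := max_u u'; rewrite cu1 eqxx => /(_ isT).
  by case/andP: wu' => _; rewrite ltnNge => /negP.
have [w' [uw' w'w]] : exists w', up u w' /\ connect up w' w.
  move: uw => /connectP[[|w' p] /= hp E]; first by rewrite E eqxx in nuw.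
  move: hp => /andP[uw' hp]; exists w'; split=> //.
  by apply/connectP; exists p.
rewrite inE wu' andbT; apply: active_up w'w; apply: colored_active => cw'.
have := max_u w'; rewrite cw' eqxx => /(_ isT).
by case/andP: uw' => _; rewrite ltnNge => /negP.
Qed.

Lemma all_coloredP c : all_colored c \/ ~ all_colored c.
Proof.
have [/forallP H|H] := boolP [forall v, c v != None].
  by left=> v; apply/eqP.
by right=> Hc; move/negP: H; apply; apply/forallP => v; apply/eqP.
Qed.

Lemma tame_wins c : tame c -> alice_wins e false c.
Proof.
have [n] := ubnP #|[set x | c x == None]|; elim: n c => // n IH c sz tc.
have [|nall] := all_coloredP c; first exact: aw_done.
apply: aw_bob => //; first by apply: not_blocked => u /tc /leq_trans; apply.
move=> v a [cv _]; have [|nall1] := all_coloredP (upd c v a); first exact: aw_done.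
have [u [b [leg tc2]]] := tame_reply tc cv nall1.
apply: aw_alice => //.
  apply: not_blocked => u'; rewrite updE; case: eqP => // _ cu'.
  rewrite active_below_upd //; apply: leq_trans (leq_card_setU _ _) _.
  by apply: (@leq_trans (1 + 1)) => //; apply: leq_add; [apply: tc|apply: chain_below].
exists u, b; split=> //; apply: IH tc2.
rewrite ltnS in sz; apply: leq_trans sz; apply: proper_card; apply/properP; split.
  by apply/subsetP => x; rewrite !inE !updE; case: (x =P u) => // _; case: (x =P v).
exists v; first by rewrite inE cv.
by rewrite !inE !updE eqxx; case: (v =P u).
Qed.

Lemma four_colors_win : alice_wins_game e 4.
Proof.
rewrite /alice_wins_game; set c0 := [ffun=> None].
have act0 u : active_below c0 u = set0.
  apply/setP => w; rewrite !inE; apply/negbTE; rewrite negb_and; apply/orP; left.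
  by rewrite negb_exists; apply/forallP => v; rewrite ffunE.
have le1 u : #|active_below c0 u| <= 1 by rewrite act0 cards0.
have [|nall] := all_coloredP c0; first exact: aw_done.
apply: aw_alice => //; first by apply: not_blocked => u _; rewrite act0 cards0.
have [u cu] : exists u, c0 u = None.
  case: (pickP (fun u => c0 u == None)) => [u /eqP|H]; first by exists u.
  by case: nall => u cu; have := H u; rewrite cu.
(* Any opening is tame, by [chain_below]. *)
have [b Hb] := exists_color (leqW (le1 u)); exists u, b; split=> //.
apply: tame_wins => u' _; rewrite active_below_upd // act0 set0U.
exact: chain_below.
Qed.

End AliceStrategy.

Theorem theorem7p2 (T : finType) (e : rel T) :
  symmetric e -> irreflexive e -> forest e ->
  0 < #|T| ->
  (forall v : T, #|[set u | e v u]| != 3) ->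
  (forall (b : T) (alpha : 'I_3), trunk_hyp e b alpha) ->
  game_chromatic_number_is e 4.
Proof.
move=> sym irr Hf T0 no3 hyp; split; last by move=> t; apply: lower_bound.
have [r [rI up1]] := elimination_order sym irr Hf.
exact: four_colors_win sym irr rI up1.
Qed.
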